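(* Let $d\ge 6$ be an integer and let $\mathcal P\subset\mathbb R^d$ be an integral convex polytope of dimension $d$. Then $$g_3(\mathcal P)\ \ge\ \begin{cases}\dfrac{1}{d!}\Big((-1)^{d-1}\,\mathrm{stirl}(d+1,4)+(d!\,\mathrm{vol}(\mathcal P)-1)\,C^d_{3,d-3}\Big), & 6\le d\le 9,\\[2mm] \dfrac{1}{d!}\Big((-1)^{d-1}\,\mathrm{stirl}(d+1,4)+(d!\,\mathrm{vol}(\mathcal P)-1)\,C^d_{3,d-2}\Big), & d\ge 10,\end{cases}$$ and this bound is best possible for any volume: for every positive integer $m$ there exists an integral convex polytope $\mathcal P$ of dimension $d$ with $d!\,\mathrm{vol}(\mathcal P)=m$ for which equality holds.
   Context: An integral convex polytope is a convex polytope in $\mathbb R^d$ all of whose vertices lie in $\mathbb Z^d$. For such $\mathcal P$ of dimension $d$, the Ehrhart polynomial is $L_{\mathcal P}(n)=|n\mathcal P\cap\mathbb Z^d|$ (a polynomial in $n$ of degree $d$), and $g_r(\mathcal P)$ denotes the coefficient of $n^r$ in $L_{\mathcal P}(n)$, $0\le r\le d$. $\mathrm{vol}$ is the usual $d$-dimensional volume. The Stirling numbers of the first kind $\mathrm{stirl}(d,i)$ are defined by $\prod_{i=0}^{d-1}(z-i)=\sum_{i=1}^d \mathrm{stirl}(d,i)z^i$. For integers $i$ and $d$, let $c_i(z)=(z+i)(z+i-1)\cdots(z+i-(d-1))=d!\binom{z+i}{d}$, and let $C^d_{r,i}$ denote the coefficient of $z^r$ in $c_i(z)$, $0\le r\le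 d$. *)

(* Defs.v *)
From HB Require Import structures.
From mathcomp Require Import all_boot all_order all_algebra finmap.
From mathcomp Require Import all_classical all_reals all_analysis.

Set Implicit Arguments.
Unset Strict Implicit.
Unset Printing Implicit Defensive.

Import Order.TTheory GRing.Theory Num.Theory.
Local Open Scope classical_set_scope.
Local Open Scope ring_scope.

Section Polytopes.
Context {R : realType} {d : nat}.
Implicit Types (A P : set 'rV[R]_d) (v : 'rV[R]_d).

Definition conv_hull A : set 'rV[R]_d :=
  [set x | exists (n : nat) (p : 'I_n -> 'rV[R]_d) (w : 'I_n -> R),
    [/\ forall i, A (p i), forall i, 0 <= w i, \sum_(i < n) w i = 1
      & x = \sum_(i < n) w i *: p i]].

Definition aff_hull A : set 'rV[R]_d :=
  [set x | exists (n : nat) (p : 'I_n -> 'rV[R]_d) (w : 'I_n -> R),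
    [/\ forall i, A (p i), \sum_(i < n) w i = 1
      & x = \sum_(i < n) w i *: p i]].

(* The affine hull of A is a translate of a k-dimensional linear subspace;
   in particular A is nonempty. *)
Definition has_dim A (k : nat) : Prop :=
  exists (v : 'rV[R]_d) (V : {vspace 'rV[R]_d}),
    aff_hull A = [set v + u | u in [set u | u \in V]] /\ \dim V = k.

Definition convex_polytope P : Prop :=
  exists A, finite_set A /\ P = conv_hull A.

(* Vertices are the extreme points. *)
Definition is_vertex P v : Prop :=
  P v /\ forall (x y : 'rV[R]_d) (t : R), P x -> P y -> 0 < t < 1 ->
    v = t *: x + (1 - t) *: y -> x = v /\ y = v.

Definition lattice : set 'rV[R]_d := [set x | forall j, x 0 j \is a Num.int].

Definition integral_polytope P : Prop :=
  convex_polytope P /\ forall v, is_vertex P v -> lattice v.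

Definition dilate (n : nat) P : set 'rV[R]_d := [set n%:R *: x | x in P].

(* [fset_set] is empty on infinite sets, but a dilate of a polytope is bounded
   and so contains finitely many lattice points. *)
Definition lattice_count P (n : nat) : nat :=
  #|` fset_set (dilate n P `&` lattice) |.

Definition is_ehrhart_poly P (p : {poly R}) : Prop :=
  forall n : nat, (0 < n)%N -> p.[n%:R] = (lattice_count P n)%:R.

(* At most one polynomial qualifies; for an integral polytope one exists by
   Ehrhart's theorem, so the default 0 is not used. *)
Definition ehrhart_poly P : {poly R} := xget 0 [set p | is_ehrhart_poly P p].

Definition ehrhart_coef (r : nat) P : R := (ehrhart_poly P)`_r.

Definition box (a b : 'rV[R]_d) : set 'rV[R]_d :=
  [set x | forall j, a 0 j <= x 0 j <= b 0 j].

Definition box_volume (a b : 'rV[R]_d) : R := \prod_(j < d) (b 0 j - a 0 j).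

(* d-dimensional Lebesgue (outer) measure: the infimum of the total volumes of
   the countable covers by boxes. *)
Definition lebesgue_outer A : \bar R :=
  ereal_inf [set s | exists a b : nat -> 'rV[R]_d,
    [/\ forall k j, a k 0 j <= b k 0 j,
        A `<=` \bigcup_k box (a k) (b k)
      & s = (\sum_(0 <= k <oo) (box_volume (a k) (b k))%:E)%E]].

(* [fine] loses nothing on polytopes, whose measure is finite. *)
Definition vol A : R := fine (lebesgue_outer A).

End Polytopes.

Definition stirl (d i : nat) : int :=
  (\prod_(k < d) ('X - (k%:Z)%:P) : {poly int})`_i.

Definition c_poly (d : nat) (i : int) : {poly int} :=
  \prod_(k < d) ('X + (i - k%:Z)%:P).

Definition c_coef (d r : nat) (i : int) : int := (c_poly d i)`_r.

Definition g3_bound {R : realType} (d : nat) (v : R) : R :=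
  if (d <= 9)%N then
    (d`!%:R)^-1 * ((-1) ^+ (d - 1) * (stirl d.+1 4)%:~R
                   + (d`!%:R * v - 1) * (c_coef d 3 (d%:Z - 3))%:~R)
  else
    (d`!%:R)^-1 * ((-1) ^+ (d - 1) * (stirl d.+1 4)%:~R
                   + (d`!%:R * v - 1) * (c_coef d 3 (d%:Z - 2))%:~R).

(* Main.v *)
Require Import Defs.
From mathcomp Require Import all_boot all_order all_algebra finmap.
From mathcomp Require Import all_classical all_reals all_analysis.
From mathcomp Require Import ring lra zify.

Set Implicit Arguments.
Unset Strict Implicit.
Unset Printing Implicit Defensive.

Import Order.TTheory GRing.Theory Num.Theory.
Import numFieldNormedType.Exports.
Local Open Scope classical_set_scope.
Local Open Scope ring_scope.

(* Write the Ehrhart polynomial L as d! L(n) = \sum_k h_k c_(d-k)(n).  Cut the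
   cone over the polytope, placed at height 1, into half-open simplicial cones:
   the cells of a regular triangulation, pushed apart by a generic interior
   direction y.  In a half-open simplicial cone every lattice point is uniquely
   a lattice point of the half-open unit box plus a nonnegative integer
   combination of the generators, so h_k counts box points at height k and is
   nonnegative, with h_0 = 1.  Reflecting the box points at height d through the
   centre of the box gives distinct lattice points of the polytope, lying in the
   cells for the opposite direction -y and never at a vertex, hence h_d <= h_1.
   Counting points of (1/n) Z^d in box covers gives \sum_k h_k = d! vol.

   It remains to minimize the coefficient of z^3 in c_j.  For j = a, d - 1 - j =
   b, both positive, it is the coefficient E(a, b) of z^2 in \prod_(k <= a) (z +
   k) \prod_(k <= b) (z - k), and |E(a, b)| <= - E(a + b - 1, 1) for a + b >= 9
   by induction from a numerical check at a + b = 9, while d <= 9 leaves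
   finitely many cases; the terms j = 0 and j = d - 1 are handled together using
   h_d <= h_1.  Equality holds for simplices of Reeve type, whose h-vector is 1
   + (m - 1) t^3 or 1 + (m - 1) t^2. *)

(** * Linear algebra of point configurations *)

(** The control of h_d shapes the proof. For even d the coefficient of z^3 in c_0 is the negative of
    the one in c_(d-1), which lies below the claimed minimum; so nonnegativity of the h-vector is
    not enough, and every unit of h_d has to be paid for by one of h_1. This is why the
    triangulation uses only the vertices of the polytope and why cells are shown disjoint for -y as
    well as for y: among the d + 1 + h_1 lattice points at height 1 one finds the N >= d + 1
    vertices and, apart from them, h_d reflected box points. Half-open cells replace
    inclusion-exclusion over common faces.

    The change at d = 10 is numerical: E(7, 1) = -64 is well above E(6, 2) = -1324, while E(8, 1) =
    -8540 is below E(7, 2) = -7900. *)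

Section Genericity.
Variable R : realFieldType.

(** Finitely many genericity conditions along a polynomial curve are met by one parameter: the
    product of the polynomials has fewer roots than the [size Q] positive integers tried. *)
Lemma exists_common_nonroot (I : finType) (q : I -> {poly R}) :
  (forall i, q i != 0) -> exists2 t : R, 0 < t & forall i, (q i).[t] != 0.
Proof.
move=> q0; pose Q := \prod_i q i.
have Q0 : Q != 0 by apply/prodf_neq0 => i _.
pose s := [seq (k.+1)%:R : R | k <- iota 0 (size Q)].
have us : uniq s.
  by rewrite map_inj_uniq ?iota_uniq// => a b /eqP; rewrite eqr_nat eqSS => /eqP.
have : ~~ all (root Q) s.
  by apply/negP => rs; have := max_poly_roots Q0 rs us; rewrite size_map size_iota ltnn.
case/allPn => t /mapP[k _ ->] nr; exists k.+1%:R; first by rewrite ltr0n.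
move=> i; apply: contra nr => /eqP qi.
by rewrite rootE /Q horner_prod (bigD1 i)//= qi mul0r.
Qed.

Lemma exists_small_scale (I : finType) (p q : I -> R) :
  exists2 e : R, 0 < e & forall i, p i != 0 -> e * `|q i| < `|p i|.
Proof.
(* Terms with [p i = 0] vanish, since the inverse of 0 is 0. *)
pose s := \sum_i `|q i| / `|p i|.
have s0 : 0 <= s by apply: sumr_ge0 => i _; rewrite divr_ge0.
have s1 : 0 < 1 + s by rewrite ltr_wpDr.
exists (1 + s)^-1; first by rewrite invr_gt0.
move=> i pi; rewrite mulrC ltr_pdivrMr// -ltr_pdivrMl ?normr_gt0// mulrC.
have : `|q i| / `|p i| <= s.
  by rewrite /s (bigD1 i)//= lerDl sumr_ge0// => j _; rewrite divr_ge0.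
by move=> h; rewrite (le_lt_trans h)// ltrDr.
Qed.

End Genericity.

Section Configuration.
Variables (R : realType) (N D : nat) (A : 'M[R]_(N, D)).
Implicit Types (S : {set 'I_N}) (l mu nu : 'rV[R]_N) (u v : 'rV[R]_D).

Definition supported S l := forall i, i \notin S -> l 0 i = 0.
Definition indep S := forall l, supported S l -> l *m A = 0 -> l = 0.
Definition spanning S := forall v, exists2 l, supported S l & l *m A = v.
Definition is_basis S := indep S /\ spanning S.
(** A vector over all [N] indices rather than over [S], so that coordinates in different bases live
    in one space. *)
Definition basis_coord S v : 'rV[R]_N :=
  xget 0 [set l | supported S l /\ l *m A = v].

Lemma supportedD S l l' : supported S l -> supported S l' -> supported S (l + l').
Proof. by move=> h h' i iS; rewrite mxE h// h'// addr0. Qed.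

Lemma supportedZ S c l : supported S l -> supported S (c *: l).
Proof. by move=> h i iS; rewrite mxE h// mulr0. Qed.

Lemma supportedB S l l' : supported S l -> supported S l' -> supported S (l - l').
Proof. by move=> h h'; rewrite -scaleN1r; apply: supportedD => //; exact: supportedZ. Qed.

Lemma supported_delta S i : i \in S -> supported S (delta_mx 0 i).
Proof. by move=> iS j jS; rewrite mxE eqxx/=; case: eqP jS => // ->; rewrite iS. Qed.

Lemma coordP S v : is_basis S -> supported S (basis_coord S v) /\ basis_coord S v *m A = v.
Proof.
move=> [_ /(_ v)[l sl lA]]; rewrite /basis_coord.
by apply: (@xgetPex _ 0 [set l | supported S l /\ l *m A = v]); exists l.
Qed.

Lemma coord_unique S l : is_basis S -> supported S l -> basis_coord S (l *m A) = l.
Proof.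
move=> bS sl; have [sc cA] := coordP (l *m A) bS.
apply/eqP; rewrite -subr_eq0; apply/eqP; apply: bS.1; first exact: supportedB.
by rewrite mulmxBl cA subrr.
Qed.

Lemma coordDZ S u c v : is_basis S ->
  basis_coord S (u + c *: v) = basis_coord S u + c *: basis_coord S v.
Proof.
move=> bS; have [su uA] := coordP u bS; have [sv vA] := coordP v bS.
rewrite -[in LHS]uA -[in LHS]vA scalemxAl -mulmxDl coord_unique//.
by apply: supportedD => //; exact: supportedZ.
Qed.

Lemma coord_mul S l : is_basis S ->
  basis_coord S (l *m A) = \sum_j l 0 j *: basis_coord S (row j A).
Proof.
move=> bS; rewrite mulmx_sum_row -[RHS](coord_unique bS); last first.
  move=> i iS; rewrite summxE big1// => j _; rewrite mxE.
  by have [-> //] := coordP (row j A) bS; rewrite mulr0.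
congr basis_coord; rewrite mulmx_suml; apply: eq_bigr => j _.
by rewrite -scalemxAl; have [_ ->] := coordP (row j A) bS.
Qed.

Lemma coord_row S i : is_basis S -> i \in S -> basis_coord S (row i A) = delta_mx 0 i.
Proof. by move=> bS iS; rewrite rowE coord_unique//; exact: supported_delta. Qed.

Lemma indepU1 S j : indep S -> (forall l, supported S l -> l *m A != row j A) ->
  indep (j |: S).
Proof.
move=> iS nj l sl lA.
have jS : l 0 j = 0.
  apply/eqP/negP => /negP lj.
  pose l' := delta_mx 0 j - (l 0 j)^-1 *: l.
  have : l' *m A != row j A.
    apply: nj => i iNS; rewrite !mxE eqxx/=; have [->|ij] := eqVneq i j.
      by rewrite mulVf// subrr.
    by rewrite (sl i) ?mulr0 ?subr0// finset.in_setU1 negb_or ij.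
  by rewrite mulmxBl -scalemxAl lA scaler0 subr0 -rowE eqxx.
apply: iS => // i iS; have [->//|ij] := eqVneq i j.
by rewrite sl// finset.in_setU1 negb_or ij.
Qed.

Hypothesis Aspan : forall v, exists l, l *m A = v.

Lemma indep_extend S : indep S -> exists S' : {set 'I_N}, S \subset S' /\ is_basis S'.
Proof.
have [n] := ubnP (#|~: S|); elim: n S => // n IH S; rewrite ltnS => cS iS.
have [sp|] := pselect (forall j, exists2 l, supported S l & l *m A = row j A).
  exists S; split=> //; split=> // v.
  have [l <-] := Aspan v.
  pose L j := sval (cid2 (sp j)).
  exists (\sum_j l 0 j *: L j).
    move=> i iNS; rewrite summxE big1// => j _; rewrite mxE /L.
    by case: cid2 => ? /= -> //; rewrite mulr0.
  rewrite mulmx_suml mulmx_sum_row; apply: eq_bigr => j _.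
  by rewrite -scalemxAl /L; case: cid2 => ? /= _ ->.
move=> /existsNP[j nj].
have jS : j \notin S.
  apply/negP => jS; apply: nj; exists (delta_mx 0 j); first exact: supported_delta.
  by rewrite rowE.
have [||S' [sS' bS']] := IH (j |: S).
- rewrite (leq_trans _ cS)// finset.setCU finset.setIC -finset.setDE.
  by rewrite [ltnRHS](cardsD1 j) finset.in_setC jS.
- apply: indepU1 => // l sl; apply/eqP => lA; apply: nj; by exists l.
- by exists S'; split=> //; apply: fintype.subset_trans sS'; exact: finset.subsetUr.
Qed.

Definition nonneg_vec l := forall i, 0 <= l 0 i.

(** The ratio test of the simplex method: [t] is the longest step against [nu] that keeps the
    coefficients nonnegative, and an index of minimal ratio drops to 0. *)
Lemma ratio_test l nu : nonneg_vec l -> (exists i, 0 < nu 0 i) ->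
  exists t i, [/\ 0 <= t, nonneg_vec (l - t *: nu), 0 < nu 0 i
    & l 0 i = t * nu 0 i].
Proof.
move=> l0 [i0 i0P].
case: (@arg_minP _ _ _ i0 (fun i => 0 < nu 0 i) (fun i => l 0 i / nu 0 i) i0P).
move=> i ip imin; have t0 : 0 <= l 0 i / nu 0 i by rewrite divr_ge0// ltW.
exists (l 0 i / nu 0 i), i; split => //; last by rewrite divfK// gt_eqF.
move=> k; rewrite !mxE subr_ge0; have [kp|kn] := ltP 0 (nu 0 k).
  by rewrite -ler_pdivlMr// imin.
by rewrite (le_trans _ (l0 k))// mulr_ge0_le0.
Qed.

Variable ht : 'cV[R]_D.
Hypothesis htA : A *m ht = const_mx 1.

Lemma height_mul l : (l *m A) *m ht = (\sum_i l 0 i)%:M.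
Proof.
rewrite -mulmxA htA; apply/matrixP => a b; rewrite !ord1 !mxE eqxx mulr1n.
by apply: eq_bigr => i _; rewrite mxE mulr1.
Qed.

Lemma sum_relation l : l *m A = 0 -> \sum_i l 0 i = 0.
Proof.
by move=> lA; have := height_mul l; rewrite lA mul0mx => /matrixP/(_ 0 0);
   rewrite !mxE eqxx mulr1n.
Qed.

(** All generators have height 1, so the coefficients of a relation add up to 0 and cannot all be
    nonpositive. This provides the positive entry that [ratio_test] needs. *)
Lemma relation_pos l : l *m A = 0 -> l != 0 -> exists i, 0 < l 0 i.
Proof.
move=> /sum_relation s0 ln0; apply: contrapT => /forallNP np.
have ln i : 0 <= - l 0 i by rewrite oppr_ge0 leNgt; apply/negP/np.
have := s0; rewrite -[X in X = 0]opprK -sumrN => /eqP; rewrite oppr_eq0.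
rewrite psumr_eq0// => /allP z; case/negP: ln0; apply/eqP/rowP => i.
by have /eqP := z i (mem_index_enum _); rewrite mxE => /eqP; rewrite oppr_eq0 => /eqP.
Qed.

(** Geometrically, [v] avoids every hyperplane spanned by a facet of a simplicial cone over a
    basis. *)
Definition generic v := forall S i, is_basis S -> i \in S -> basis_coord S v 0 i != 0.

(** While the support is dependent, the ratio test along a relation removes an index from it; an
    independent support extends to a basis with zero coefficients. *)
Lemma caratheodory l : nonneg_vec l -> generic (l *m A) ->
  exists S, is_basis S /\ nonneg_vec (basis_coord S (l *m A)).
Proof.
move=> + gl; have [n] := ubnP #|[set i | l 0 i != 0]%SET|.
elim: n l gl => // n IH l gl; rewrite ltnS => cl l0.
set S := [set i | l 0 i != 0]%SET in cl.
have sl : supported S l by move=> i; rewrite finset.in_set negbK => /eqP.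
have [iS|] := pselect (indep S).
  have [S' [SS' bS']] := indep_extend iS.
  exists S'; split=> //; rewrite coord_unique// => i iS'; apply: sl.
  by apply: contra iS' => /(fintype.subsetP SS').
move=> /existsNP[nu /not_implyP[snu /not_implyP[nuA /eqP nu0]]].
have [t [i [t0 lt0 nui li]]] := ratio_test l0 (relation_pos nuA nu0).
have e : (l - t *: nu) *m A = l *m A.
  by rewrite mulmxBl -scalemxAl nuA scaler0 subr0.
rewrite -e; apply: IH => //; first by rewrite e.
rewrite (leq_trans _ cl)//; apply: proper_card; apply/properP; split.
  apply/fintype.subsetP => k; rewrite !finset.in_set; apply: contra => /eqP lk.
  by rewrite !mxE lk (snu k) ?mulr0 ?subr0// finset.in_set lk eqxx.
have iS : i \in S.
  by apply/negPn/negP => /snu ni; rewrite ni ltxx in nui.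
by exists i => //; rewrite finset.in_set negbK !mxE li subrr.
Qed.

Lemma basis_pivot S i j : is_basis S -> i \in S -> j \notin S ->
  basis_coord S (row j A) 0 i != 0 -> is_basis (j |: S :\ i).
Proof.
move=> bS iS jS mui; have [smu muA] := coordP (row j A) bS.
set mu := basis_coord S (row j A) in mui smu muA.
have inS' k : (k \in j |: S :\ i) = (k == j) || (k != i) && (k \in S).
  by rewrite finset.in_setU1 finset.in_setD1.
split=> [l sl lA|v].
  (* Rewriting [row j A] through [S] turns the relation into one supported on [S], which vanishes;
     its entry at [i] then forces [l 0 j = 0]. *)
  pose l' := l - l 0 j *: delta_mx 0 j + l 0 j *: mu.
  have sl' : supported S l'.
    move=> k kS; rewrite /l' !mxE (smu k kS) mulr0 addr0 eqxx/=.
    have [->|kj] := eqVneq k j; first by rewrite mulr1 subrr.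
    by rewrite mulr0 subr0 sl// inS' negb_or kj negb_and kS orbT.
  have l'A : l' *m A = 0.
    by rewrite /l' mulmxDl mulmxBl lA -!scalemxAl muA -rowE sub0r addNr.
  have l'0 := bS.1 _ sl' l'A.
  have ij : i != j by apply: contraNneq jS => <-.
  have li : l 0 i = 0 by rewrite sl// inS' eqxx (negbTE ij).
  have lj : l 0 j = 0.
    have := congr1 (fun z : 'rV_N => z 0 i) l'0; rewrite /l' !mxE li eqxx (negbTE ij)/=.
    by rewrite mulr0 subr0 add0r => /eqP; rewrite mulf_eq0 (negbTE mui) orbF => /eqP.
  by move: l'0; rewrite /l' lj !scale0r addr0 subr0.
have [sv vA] := coordP v bS; set c := basis_coord S v in sv vA.
(* This multiple of the relation [mu - delta_mx 0 j] cancels the coefficient at [i]. *)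
exists (c - (c 0 i / mu 0 i) *: (mu - delta_mx 0 j)).
  move=> k; rewrite inS' negb_or negb_and negbK => /andP[kj /orP[/eqP->|kS]].
    have ij : i != j by apply: contraNneq jS => <-.
    by rewrite !mxE eqxx (negbTE ij)/= subr0 divfK// subrr.
  by rewrite !mxE (sv k kS) (smu k kS) eqxx (negbTE kj)/= subr0 mulr0 subr0.
by rewrite mulmxBl -scalemxAl mulmxBl muA -rowE subrr scaler0 subr0.
Qed.

(** * Regular triangulations *)

Variable w : 'I_N -> R.

(** For a basis [S], the linear function that interpolates the heights [w] on the generators in
    [S]. *)
Definition lift_fun S v := \sum_i basis_coord S v 0 i * w i.

Hypothesis wgen : forall S j, is_basis S -> j \notin S ->
  w j != lift_fun S (row j A).

(* The cells of the regular triangulation with heights [w] are the bases whose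
   lifts lie below all other lifted points. *)
Definition cell S := is_basis S /\
  forall j, j \notin S -> lift_fun S (row j A) < w j.

Lemma lift_fun_row S i : is_basis S -> i \in S -> lift_fun S (row i A) = w i.
Proof.
move=> bS iS; rewrite /lift_fun coord_row// (bigD1 i)//= big1 => [|k ki].
  by rewrite mxE !eqxx mul1r addr0.
by rewrite mxE (negbTE ki) mul0r.
Qed.

Lemma lift_fun_mul S l : is_basis S ->
  lift_fun S (l *m A) = \sum_j l 0 j * lift_fun S (row j A).
Proof.
move=> bS; rewrite /lift_fun coord_mul//.
under eq_bigr do rewrite summxE mulr_suml.
rewrite exchange_big/=; apply: eq_bigr => j _; rewrite mulr_sumr.
by apply: eq_bigr => i _; rewrite mxE mulrA.
Qed.

(** The linear function of a cell is at most [w] on all generators and strictly smaller off [S];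
    weighting by nonnegative coefficients gives the bound together with its equality case. *)
Lemma cell_lift_le S S' v : cell S -> is_basis S' -> nonneg_vec (basis_coord S' v) ->
  lift_fun S v <= lift_fun S' v ?= iff
    [forall i, (0 < basis_coord S' v 0 i) ==> (i \in S)].
Proof.
move=> [bS cS] bS' pos; have [s' vA] := coordP v bS'.
rewrite -{1}vA lift_fun_mul//; rewrite /lift_fun -/(lift_fun _ _).
set c := basis_coord S' v in pos s' *.
have h i : c 0 i * lift_fun S (row i A) <= c 0 i * w i ?= iff
    ((0 < c 0 i) ==> (i \in S)).
  have [iS|iS] := boolP (i \in S).
    by rewrite implybT lift_fun_row//; exact/leif_refl.
  have := cS i iS => lw; rewrite implybF -leNgt.
  have := pos i; rewrite le_eqVlt => /orP[/eqP <-|ci].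
    by rewrite !mul0r lexx; exact/leif_refl.
  rewrite leNgt ci/=; split; first by rewrite ler_pM2l// ltW.
  by apply/negbTE; rewrite lt_eqF// ltr_pM2l.
exact: (leif_sum (fun i _ => h i)).
Qed.

(** Interiors of cells are disjoint: [cell_lift_le] in both directions gives equal lifts, and its
    equality case gives both inclusions. *)
Lemma cell_unique_pos S S' v : cell S -> cell S' ->
  (forall i, i \in S -> 0 < basis_coord S v 0 i) ->
  (forall i, i \in S' -> 0 < basis_coord S' v 0 i) -> S = S'.
Proof.
move=> cS cS' p p'.
have nn T : is_basis T -> (forall i, i \in T -> 0 < basis_coord T v 0 i) ->
    nonneg_vec (basis_coord T v).
  move=> bT pT i; have [/pT/ltW //|/((coordP v bT).1) ->//] := boolP (i \in T).
have [le1 eq1] := cell_lift_le cS cS'.1 (nn _ cS'.1 p').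
have [le2 eq2] := cell_lift_le cS' cS.1 (nn _ cS.1 p).
have e : lift_fun S v = lift_fun S' v by apply/eqP; rewrite eq_le le1.
move: eq1 eq2; rewrite e eqxx => /esym/forallP h1 /esym/forallP h2.
apply/eqP; rewrite finset.eqEsubset; apply/andP; split; apply/fintype.subsetP => i iT.
- by apply: (implyP (h2 i)); exact: p.
- by apply: (implyP (h1 i)); exact: p'.
Qed.

(** Among the bases whose cone contains the point, one of minimal lift is a cell: a lifted generator
    below its hyperplane could be pivoted in and would lower the lift. *)
Lemma cell_exists_pos l : nonneg_vec l -> generic (l *m A) ->
  exists2 S, cell S & forall i, i \in S -> 0 < basis_coord S (l *m A) 0 i.
Proof.
move=> l0 gl; have [S0 [bS0 pS0]] := caratheodory l0 gl.
set v := l *m A in gl bS0 pS0 *.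
pose ok S := `[< is_basis S /\ nonneg_vec (basis_coord S v) >].
have ok0 : ok S0 by apply/asboolP.
case: (@arg_minP _ _ _ S0 ok (fun S => lift_fun S v) ok0).
move=> S /asboolP[bS pS] Smin.
have pos i : i \in S -> 0 < basis_coord S v 0 i.
  by move=> iS; rewrite lt_neqAle pS eq_sym gl.
exists S => //; split=> // j jS; rewrite lt_neqAle eq_sym wgen//=.
rewrite leNgt; apply/negP => wj.
have [smu muA] := coordP (row j A) bS.
set mu := basis_coord S (row j A) in smu muA.
have [sv vA] := coordP v bS; set c := basis_coord S v in sv vA pS pos.
(* The index [j] enters along the relation that expresses [row j A] through [S]; its entry at [j] is
   -1, so the blocking index lies in [S]. *)
pose nu := mu - delta_mx 0 j.
have nuA : nu *m A = 0 by rewrite mulmxBl muA -rowE subrr.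
have nuj : nu 0 j = -1 by rewrite !mxE smu// !eqxx sub0r.
have nu0 : nu != 0.
  by apply/eqP => n0; move: nuj; rewrite n0 mxE => /eqP; rewrite eq_sym oppr_eq0 oner_eq0.
have [t [i [t0 lt0 nui li]]] := ratio_test pS (relation_pos nuA nu0).
have ij : i != j by apply: contraTneq nui => ->; rewrite nuj oppr_gt0 ltr10.
have nuik : nu 0 i = mu 0 i by rewrite !mxE (negbTE ij) andbF subr0.
have iS : i \in S.
  by apply: contraT => /smu m0; rewrite nuik m0 ltxx in nui.
have mui : mu 0 i != 0 by rewrite -nuik gt_eqF.
(* By genericity the coordinates over [S] are positive, so the step is not degenerate and the lift
   strictly decreases. *)
have tp : 0 < t.
  rewrite lt_neqAle t0 andbT eq_sym; apply/eqP => t00.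
  by have := pos i iS; rewrite li t00 mul0r ltxx.
have bS' := basis_pivot bS iS jS mui.
have e : (c - t *: nu) *m A = v.
  by rewrite mulmxBl -scalemxAl nuA scaler0 subr0.
have cS' : basis_coord (j |: S :\ i) v = c - t *: nu.
  rewrite -{1}e coord_unique// => k; rewrite finset.in_setU1 finset.in_setD1.
  rewrite negb_or negb_and negbK => /andP[kj /orP[/eqP->|kS]].
    by rewrite mxE li !mxE subrr.
  by rewrite !mxE (sv k kS) (smu k kS) (negbTE kj) andbF subr0 mulr0 subr0.
have := Smin (j |: S :\ i); rewrite /ok => /(_ _)/wrap[].
  by apply/asboolP; split=> //; rewrite cS'.
apply/negP; rewrite -ltNge /lift_fun cS' -/c.
have -> : \sum_k (c - t *: nu) 0 k * w k =
    (\sum_k c 0 k * w k) - t * (lift_fun S (row j A) - w j).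
  rewrite /lift_fun -/mu mulrBr mulr_sumr.
  under eq_bigr do rewrite !mxE mulrBl -mulrA mulrBl mulrBr.
  rewrite !sumrB; congr (_ - (_ - _)).
  rewrite (bigD1 j)//= big1 ?eqxx ?mul1r ?addr0// => k kj.
  by rewrite (negbTE kj) mul0r mulr0.
by rewrite ltrBlDr ltrDl mulr_gt0// subr_gt0.
Qed.

End Configuration.

(** * Half-open triangulations *)

Section HalfOpenTriangulation.
Variables (R : realType) (N D : nat) (A : 'M[R]_(N, D)).
Implicit Types (S : {set 'I_N}) (l : 'rV[R]_N) (u v y : 'rV[R]_D).
Hypothesis Aspan : forall v, exists l, l *m A = v.
Variable ht : 'cV[R]_D.
Hypothesis htA : A *m ht = const_mx 1.

(** Heights [t ^+ i]: each condition is a polynomial in [t] with coefficient 1 at ['X^j], because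
    [row j A] has coordinates supported in [S] and [j] is not in [S]. *)
Lemma exists_generic_lift : exists w : 'I_N -> R, forall S j,
  is_basis A S -> j \notin S -> w j != lift_fun A w S (row j A).
Proof.
pose q (Sj : {set 'I_N} * 'I_N) : {poly R} :=
  if `[< is_basis A Sj.1 /\ Sj.2 \notin Sj.1 >] then
    'X^(val Sj.2) - \sum_i basis_coord A Sj.1 (row Sj.2 A) 0 i *: 'X^i else 1.
have [|t t0 tq] := @exists_common_nonroot R _ q.
  move=> [S j]; rewrite /q/=; case: asboolP => [[bS jS]|_]; last exact: oner_neq0.
  apply/eqP => /(congr1 (fun p : {poly R} => p`_j))/eqP.
  rewrite coefB coefXn eqxx coef0 coef_sum (bigD1 j)//= coefZ coefXn eqxx.
  rewrite ((coordP _ bS).1 _ jS) mul0r add0r big1 ?subr0 ?oner_eq0// => i ij.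
  by rewrite coefZ coefXn eq_sym (inj_eq val_inj) (negbTE ij) mulr0.
exists (fun i => t ^+ i) => S j bS jS; have := tq (S, j); rewrite /q/=.
case: asboolP => [_|[]//]; rewrite hornerD hornerN hornerXn horner_sum subr_eq0.
by under eq_bigr do rewrite hornerZ hornerXn.
Qed.

(** Again with weights [t ^+ i]: the coordinate at [i] is a polynomial in [t] whose coefficient at
    ['X^i] is 1. *)
Lemma exists_generic_pos : exists2 l : 'rV_N, (forall i, 0 < l 0 i) & generic A (l *m A).
Proof.
pose q (Si : {set 'I_N} * 'I_N) : {poly R} :=
  if `[< is_basis A Si.1 /\ Si.2 \in Si.1 >] then
    \sum_j basis_coord A Si.1 (row j A) 0 Si.2 *: 'X^j else 1.
have [|t t0 tq] := @exists_common_nonroot R _ q.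
  move=> [S i]; rewrite /q/=; case: asboolP => [[bS iS]|_]; last exact: oner_neq0.
  apply/eqP => /(congr1 (fun p : {poly R} => p`_i))/eqP.
  rewrite coef0 coef_sum (bigD1 i)//= coefZ coefXn eqxx coord_row// mxE !eqxx.
  rewrite big1 ?addr0 ?mulr1 ?oner_eq0// => j ji.
  by rewrite coefZ coefXn eq_sym (inj_eq val_inj) (negbTE ji) mulr0.
exists (\row_i t ^+ i); first by move=> i; rewrite mxE exprn_gt0.
move=> S i bS iS; have := tq (S, i); rewrite /q/=.
case: asboolP => [_|[]//]; rewrite horner_sum coord_mul// summxE.
by under eq_bigr do rewrite hornerZ hornerXn mulrC; under [in X in _ -> X]eq_bigr do rewrite !mxE.
Qed.

(* For generic [y], this says that [v + e *: y] is interior to the cone over [S]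
   for all small [e > 0]. *)
Definition half_open y S v := forall i, i \in S ->
  if basis_coord A S y 0 i < 0 then 0 < basis_coord A S v 0 i else 0 <= basis_coord A S v 0 i.

(** For small [e] a nonzero coordinate of [v] keeps its sign and a zero one takes the sign of [y].
    Statements on half-open cones thus reduce to statements on interiors. *)
Lemma perturbation y v : generic A y -> exists e,
  [/\ 0 < e, generic A (v + e *: y) & forall S, is_basis A S ->
    (half_open y S v <-> forall i, i \in S -> 0 < basis_coord A S (v + e *: y) 0 i)].
Proof.
move=> gy; have [e e0 eP] := @exists_small_scale R ({set 'I_N} * 'I_N)%type
  (fun Si => basis_coord A Si.1 v 0 Si.2) (fun Si => basis_coord A Si.1 y 0 Si.2).
have E S i : is_basis A S ->
    basis_coord A S (v + e *: y) 0 i = basis_coord A S v 0 i + e * basis_coord A S y 0 i.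
  by move=> bS; rewrite coordDZ// !mxE.
exists e; split=> // [S i bS iS|S bS].
  rewrite E//; have [->|/(eP (S, i))/= lt] := eqVneq (basis_coord A S v 0 i) 0.
    by rewrite add0r mulf_neq0 ?gy// gt_eqF.
  rewrite addr_eq0; apply/eqP => h; move: lt.
  by rewrite h normrN normrM gtr0_norm// ltxx.
suff h i : i \in S -> (if basis_coord A S y 0 i < 0 then 0 < basis_coord A S v 0 i
    else 0 <= basis_coord A S v 0 i) = (0 < basis_coord A S (v + e *: y) 0 i).
  by split=> hS i iS; have := hS i iS; rewrite h.
move=> iS; rewrite E//; have yn0 := gy S i bS iS.
have [v0|vn0] := eqVneq (basis_coord A S v 0 i) 0.
  rewrite v0 add0r ltxx lexx pmulr_rgt0//.
  by case: ltgtP yn0 => // ->; rewrite eqxx.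
have /= := eP (S, i) vn0; move: vn0.
move: (basis_coord A S v 0 i) (basis_coord A S y 0 i) => a b an0.
rewrite -[e in e * `|_|]gtr0_norm// -normrM.
have : e * b < 0 = (b < 0) by rewrite pmulr_rlt0.
move: (e * b) => c <- h; have [c0|c0] := ltP c 0.
  move: h; rewrite (ltr0_norm c0); have [a0|a0|a0] := ltgtP 0 a => h.
  - by move: h; rewrite gtr0_norm// => h; apply/esym; lra.
  - by apply/esym/negbTE; rewrite -leNgt; lra.
  - by rewrite -a0 eqxx in an0.
move: h; rewrite (ger0_norm c0); have [a0|a0|a0] := ltgtP 0 a => h.
- by move: h; rewrite gtr0_norm// => h; apply/esym; lra.
- by move: h; rewrite ltr0_norm// => h; apply/esym/negbTE; rewrite -leNgt; lra.
- by rewrite -a0 eqxx in an0.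
Qed.

Lemma half_open_unique w y S S' v : generic A y -> cell A w S -> cell A w S' ->
  half_open y S v -> half_open y S' v -> S = S'.
Proof.
move=> gy cS cS' h h'; have [e [e0 _ eP]] := perturbation v gy.
by apply: (cell_unique_pos cS cS'); [apply/(eP S cS.1).1|apply/(eP S' cS'.1).1].
Qed.

Lemma half_open_exists w l0 l :
  (forall S j, is_basis A S -> j \notin S -> w j != lift_fun A w S (row j A)) ->
  (forall i, 0 < l0 0 i) -> generic A (l0 *m A) -> nonneg_vec l ->
  exists2 S, cell A w S & half_open (l0 *m A) S (l *m A).
Proof.
move=> wgen l0p gy lp; have [e [e0 ge eP]] := perturbation (l *m A) gy.
have E : l *m A + e *: (l0 *m A) = (l + e *: l0) *m A.
  by rewrite mulmxDl scalemxAl.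
have [||S cS pS] := @cell_exists_pos _ _ _ _ Aspan _ htA _ wgen (l + e *: l0).
- by move=> i; rewrite !mxE addr_ge0// mulr_ge0// ltW.
- by rewrite -E.
- by exists S => //; apply/(eP S cS.1); rewrite E.
Qed.

Lemma half_open_cone y S v : is_basis A S -> half_open y S v ->
  nonneg_vec (basis_coord A S v).
Proof.
move=> bS h i; have [iS|/((coordP v bS).1)->//] := boolP (i \in S).
by have := h i iS; case: ifP => // _ /ltW.
Qed.

(** Covering needs an interior direction, so that the perturbed point stays in the cone.
    Disjointness is kept for every generic [y], because it is also applied to the opposite
    direction. *)
Theorem half_open_decomposition : exists (T : {set {set 'I_N}}) l0,
  [/\ forall i, 0 < l0 0 i, generic A (l0 *m A),
      forall S, S \in T -> is_basis A S,
      forall l, nonneg_vec l -> exists2 S, S \in T & half_open (l0 *m A) S (l *m A)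
    & forall y, generic A y -> forall S S' v, S \in T -> S' \in T ->
      half_open y S v -> half_open y S' v -> S = S'].
Proof.
have [w wgen] := exists_generic_lift.
have [l0 l0p gy] := exists_generic_pos.
exists [set S | `[< cell A w S >]]%SET, l0; split=> //.
- by move=> S; rewrite finset.in_set => /asboolP[].
- move=> l lp; have [S cS hS] := half_open_exists wgen l0p gy lp.
  by exists S => //; rewrite finset.in_set; apply/asboolP.
- move=> y gy' S S' v; rewrite !finset.in_set => /asboolP cS /asboolP cS'.
  exact: (half_open_unique gy' cS cS').
Qed.

End HalfOpenTriangulation.

(** * Lattice points in half-open simplicial cones *)

Section Cardinality.
Variables (T U : choiceType).
Implicit Types (X : set T) (Y : set U).

Definition ncard (V : choiceType) (X : set V) : nat := #|` fset_set X|.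

Lemma ncard_image (f : T -> U) X : finite_set X -> {in X &, injective f} ->
  ncard (f @` X) = ncard X.
Proof.
move=> fX fi; rewrite /ncard fset_set_image// card_in_imfset//= => x y.
by rewrite !in_fset_set//; exact: fi.
Qed.

Lemma ncard_le X X' : finite_set X' -> X `<=` X' -> (ncard X <= ncard X')%N.
Proof.
move=> fX' XX'; have fX := sub_finite_set XX' fX'.
by apply: fsubset_leq_card; rewrite -fset_set_sub.
Qed.

Lemma ncard_fibers (g : T -> U) X Y : finite_set X -> finite_set Y ->
  (forall x, X x -> Y (g x)) ->
  ncard X = (\sum_(u <- fset_set Y) ncard [set x | X x /\ g x = u])%N.
Proof.
move=> fX fY gXY; rewrite /ncard finmap.card_fset_sum1.
transitivity (\sum_(x <- fset_set X) \sum_(u <- fset_set Y | g x == u) 1)%N.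
  rewrite big_seq [RHS]big_seq; apply: eq_bigr => x.
  rewrite in_fset_set// inE => Xx.
  rewrite (eq_bigl (pred1 (g x))); last by move=> u; rewrite eq_sym.
  rewrite sum1_count count_uniq_mem ?fset_uniq// in_fset_set// mem_set//.
  exact: gXY.
rewrite (exchange_big_dep predT)//=; apply: eq_bigr => u _.
rewrite big_fset_condE/= -finmap.card_fset_sum1; congr #|` _|.
have fS : finite_set [set x | X x /\ g x = u].
  by apply: sub_finite_set fX => x [].
apply/fsetP => x; rewrite in_fset_set// !inE/= in_fset_set//.
by apply/andP/idP => [[/set_mem Xx /eqP gx]|/set_mem[Xx gx]];
  [apply/mem_set|split; [apply/mem_set|apply/eqP]].
Qed.

End Cardinality.

Lemma ncard_fin (T : choiceType) (I : finType) (g : T -> I) (X : set T) :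
  finite_set X -> ncard X = (\sum_i ncard [set x | X x /\ g x = i])%N.
Proof.
move=> fX; have fI : finite_set [set: I] by exact: finite_finset.
rewrite (ncard_fibers (g := g) fX fI)//.
have -> : fset_set [set: I] = [fset i | i in I]%fset.
  by apply/fsetP => i; rewrite in_fset_set// !inE/=; apply/mem_set.
by rewrite big_imfset//= big_enum.
Qed.

Lemma ncard_finType (I : finType) (T : choiceType) (P : {set I}) (f : I -> T) :
  {in P &, injective f} -> ncard [set f i | i in [set` P]] = #|P|.
Proof.
move=> fi; have fP : finite_set [set` P] by exact: finite_finpred.
rewrite ncard_image//; last by move=> i j /set_mem/= iP /set_mem; exact: fi.
rewrite /ncard (_ : fset_set _ = [fset i | i in P]%fset).
  rewrite card_imfset//=; exact/esym/cardE.
by apply/fsetP => i; rewrite in_fset_set// !inE/=; apply/idP/idP => [/set_mem|iP]//; apply/mem_set.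
Qed.

Lemma ncard_eq0 (T : choiceType) (X : set T) : (forall x, ~ X x) -> ncard X = 0%N.
Proof.
by move=> X0; rewrite (_ : X = set0) ?/ncard ?fset_set0//; apply/seteqP; split=> x // /X0.
Qed.

Lemma finite_lattice_comb (R : realType) (N D : nat) (A : 'M[R]_(N, D)) (K : R) :
  finite_set [set x | lattice x /\ exists l : 'rV_N,
    x = l *m A /\ forall i, `|l 0 i| <= K].
Proof.
pose K' := \sum_i \sum_j `|K| * `|A i j|; pose M := Num.bound K'.
have KM : K' < M%:R.
  by rewrite /M archi_boundP// !sumr_ge0// => i _; rewrite sumr_ge0// => j _; rewrite mulr_ge0.
pose f (g : {ffun 'I_D -> 'I_(M + M).+1}) : 'rV[R]_D := \row_j ((g j)%:R - M%:R).
apply: (@sub_finite_set _ _ [set f g | g in [set: {ffun 'I_D -> 'I_(M + M).+1}]]);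
  last by apply: finite_image; exact: finite_finset.
move=> x [xl [l [xE lK]]].
have xK j : `|x 0 j| < M%:R.
  apply: le_lt_trans KM; rewrite xE mxE (le_trans (ler_norm_sum _ _ _))//.
  apply: ler_sum => i _; rewrite (bigD1 j)//= normrM.
  rewrite ler_wpDr//; first by apply: sumr_ge0 => k _; rewrite mulr_ge0.
  by rewrite ler_wpM2r// (le_trans (lK i))// ler_norm.
exists [ffun j => inord `|(Num.floor (x 0 j) + M%:Z)%R|%N] => //.
apply/rowP => j; rewrite mxE ffunE; have /intrP[z xz] := xl j.
have := xK j; rewrite xz ltr_norml -[M%:R]/(M%:Z%:~R : R) -mulrNz !ltr_int => /andP[z1 z2].
rewrite intrKfloor inordK; last lia.
by rewrite -[_%:R]/((_%:Z)%:~R : R) gez0_abs; [rewrite intrD addrK|lia].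
Qed.

Section SimplicialCone.
Variables (R : realType) (d : nat) (B : 'M[R]_d.+1) (sg : 'I_d.+1 -> bool).
Implicit Types x b : 'rV[R]_d.+1.
Hypotheses (Bu : B \in unitmx) (Bl : forall i, lattice (row i B))
  (Bh : forall i, B i 0 = 1).
Let c x := x *m invmx B.

(* [sg] marks the facets removed from the cone. *)
Definition in_half_open x := forall i,
  if sg i then 0 < (x *m invmx B) 0 i else 0 <= (x *m invmx B) 0 i.
Definition in_box x := lattice x /\ forall i,
  if sg i then 0 < (x *m invmx B) 0 i <= 1 else 0 <= (x *m invmx B) 0 i < 1.
Definition slice (n : nat) := [set x | [/\ lattice x, in_half_open x & x 0 0 = n%:R]].
Definition box_slice (k : nat) := [set x | in_box x /\ x 0 0 = k%:R].

(** On a removed facet the remainder must lie in (0, 1] instead of [0, 1), whence the ceiling minus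
    one. *)
Definition ipart (s : bool) (r : R) : int :=
  if s then Num.ceil r - 1 else Num.floor r.

Lemma ipartP s r : if s then 0 < r - (ipart s r)%:~R <= 1
  else 0 <= r - (ipart s r)%:~R < 1.
Proof.
have := floor_itv r; have := floor_itv (- r); rewrite /ipart ceilNfloor.
by case: s; rewrite ?intrD ?mulrNz => /andP[a1 a2] /andP[b1 b2]; apply/andP; split; lra.
Qed.

Lemma ipart_eq s r (m : int) : (if s then 0 < r <= 1 else 0 <= r < 1) ->
  ipart s (r + m%:~R) = m.
Proof.
move=> h; have := ipartP s (r + m%:~R); move: (ipart _ _) => k h'.
have [k1 k2] : (m%:~R - k%:~R : R) < 1%:~R /\ (k%:~R - m%:~R : R) < 1%:~R.
  by case: s h h' => /andP[? ?] /andP[? ?]; split; lra.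
by move: k1 k2; rewrite -!intrB !ltr_int; lia.
Qed.

Lemma lattice_comb (N : nat) (A : 'M[R]_(N, d.+1)) (z : 'I_N -> int) :
  (forall i, lattice (row i A)) -> lattice ((\row_i (z i)%:~R) *m A).
Proof.
move=> Al j; rewrite mxE rpred_sum// => i _; rewrite mxE rpredM ?intr_int//.
by have := Al i j; rewrite mxE.
Qed.

Lemma latticeD (D : nat) (u v : 'rV[R]_D) : lattice u -> lattice v -> lattice (u + v).
Proof. by move=> lu lv j; rewrite mxE rpredD ?lu ?lv. Qed.

Lemma latticeB (D : nat) (u v : 'rV[R]_D) : lattice u -> lattice v -> lattice (u - v).
Proof. by move=> lu lv j; rewrite !mxE rpredB ?lu ?lv. Qed.

Lemma height_comb (l : 'rV[R]_d.+1) : (l *m B) 0 0 = \sum_i l 0 i.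
Proof. by rewrite mxE; apply: eq_bigr => i _; rewrite Bh mulr1. Qed.

Lemma height_coord x : x 0 0 = \sum_i c x 0 i.
Proof. by rewrite -height_comb /c mulmxKV. Qed.

Definition frac_part x := x - (\row_i (ipart (sg i) (c x 0 i))%:~R) *m B.

Lemma coord_frac_part x i :
  c (frac_part x) 0 i = c x 0 i - (ipart (sg i) (c x 0 i))%:~R.
Proof. by rewrite /frac_part {1}/c mulmxBl mulmxK// !mxE. Qed.

Lemma frac_part_box x : lattice x -> in_box (frac_part x).
Proof.
move=> xl; split; first by apply: latticeB => //; exact: lattice_comb.
by move=> i; have := ipartP (sg i) (c x 0 i); rewrite -coord_frac_part.
Qed.

Lemma ipart_ge0 x i : in_half_open x -> 0 <= ipart (sg i) (c x 0 i).
Proof.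
move=> /(_ i) h; have := ipartP (sg i) (c x 0 i); move: h; rewrite -/(c x).
move: (ipart _ _) => k h k'; have : (-1)%:~R < k%:~R :> R.
  by rewrite mulrNz; case: (sg i) h k' => h /andP[? ?]; lra.
by rewrite ltr_int.
Qed.

Lemma frac_part_add b (t : 'I_d.+1 -> nat) : in_box b ->
  frac_part (b + (\row_i (t i)%:R) *m B) = b.
Proof.
move=> [_ bb]; set v := \row_i (t i)%:R; rewrite /frac_part.
rewrite (_ : (\row_i _) = v) ?addrK//; apply/rowP => i; rewrite mxE [RHS]mxE.
rewrite /c mulmxDl mulmxK// [X in ipart _ X]mxE [X in _ + X]mxE -[(t i)%:R]/((t i)%:Z%:~R : R).
by rewrite ipart_eq//; exact: bb.
Qed.

Lemma finite_box : finite_set in_box.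
Proof.
apply: sub_finite_set (finite_lattice_comb B 1) => x [xl xb]; split=> //.
exists (c x); rewrite /c mulmxKV//; split=> // i; have := xb i; rewrite -/(c x).
by case: (sg i) => /andP[? ?]; rewrite ler_norml; apply/andP; split; lra.
Qed.

Lemma finite_slice n : finite_set (slice n).
Proof.
apply: sub_finite_set (finite_lattice_comb B n%:R) => x [xl xh xn]; split=> //.
have xp i : 0 <= c x 0 i by have := xh i; case: ifP => // _ /ltW.
exists (c x); rewrite /c mulmxKV//; split=> // i; rewrite -/(c x).
by rewrite ger0_norm// -xn height_coord (bigD1 i)//= lerDl sumr_ge0.
Qed.

(** All generators have height 1, so the points over [b] correspond to the [d + 1] nonnegative
    integers with sum [n - k]. *)
Lemma ncard_slice_fiber n k b : in_box b -> b 0 0 = k%:R -> (k <= d)%N ->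
  ncard [set x | slice n x /\ frac_part x = b] = 'C(n + d - k, d).
Proof.
move=> bb bk kd; have E x : slice n x -> frac_part x = b ->
    n%:Z = k%:Z + \sum_i ipart (sg i) (c x 0 i).
  move=> [xl xh xn] xb; apply: (@intr_inj R).
  have := congr1 (fun v : 'rV[R]_d.+1 => v 0 0) xb; rewrite bk /frac_part.
  rewrite mxE [X in _ + X]mxE height_comb xn => /eqP; rewrite subr_eq => /eqP.
  rewrite intrD rmorph_sum/= -[n%:~R]/(n%:R : R) => ->; congr (_ + _).
  by apply: eq_bigr => i _; rewrite mxE.
(* For [n < k] the number [n + d - k] is below [d], so the binomial is 0 like the fiber. *)
have [kn|nk] := leqP k n; last first.
  rewrite bin_small ?ncard_eq0//; last lia.
  move=> x [xs xb]; have := E x xs xb; have [_ xh _] := xs.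
  have : 0 <= \sum_i ipart (sg i) (c x 0 i).
    by apply: sumr_ge0 => i _; exact: ipart_ge0.
  lia.
have -> : (n + d - k = d + (n - k))%N by lia.
rewrite -card_ord_partitions.
pose f (t : d.+1.-tuple 'I_(n - k).+1) := b + (\row_i (tnth t i)%:R) *m B.
rewrite -(@ncard_finType _ _ _ f); last first.
  move=> t t' _ _ /addrI/(congr1 (fun v => v *m invmx B)).
  rewrite !mulmxK// => /rowP tt'; apply: eq_from_tnth => i; apply: val_inj.
  by have /eqP := tt' i; rewrite !mxE eqr_nat => /eqP.
congr ncard; apply/seteqP; split=> x /=.
  move=> [xs xb]; have := E x xs xb; have [xl xh xn] := xs => nk.
  have ge0 i := @ipart_ge0 x i xh.
  have le i : ipart (sg i) (c x 0 i) <= (n - k)%N%:Z.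
    have : 0 <= \sum_(j | j != i) ipart (sg j) (c x 0 j).
      by apply: sumr_ge0 => j _; exact: ge0.
    move: nk (ge0 i); rewrite (bigD1 i)//=; clear -kn.
    by move: (ipart _ _) (\sum_(j | _) _) => a s; lia.
  pose t := [tuple (inord `|ipart (sg i) (c x 0%R i)|%N : 'I_(n - k).+1) | i < d.+1].
  have tE i : (tnth t i : nat)%:Z = ipart (sg i) (c x 0 i).
    rewrite tnth_mktuple inordK; first by rewrite gez0_abs.
    by move: (ge0 i) (le i); clear; lia.
  exists t.
    rewrite finset.in_set big_tuple -eqz_nat -!natz natr_sum.
    under eq_bigr do rewrite natz tE.
    by rewrite natz -subzn// nk addrAC subrr add0r.
  rewrite /f -xb /frac_part [X in _ + X *m B](_ : _ =
    \row_i (ipart (sg i) (c x 0 i))%:~R) ?subrK//.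
  by apply/rowP => i; rewrite [LHS]mxE [RHS]mxE -tE.
move=> [t]; rewrite finset.in_set => /eqP st <-; split; last exact: frac_part_add.
have [bl bb'] := bb; split.
- apply: latticeD => //; exact: (@lattice_comb _ _ (fun i => (tnth t i)%:Z)).
- move=> i; rewrite mulmxDl mulmxK// !mxE; have := bb' i; rewrite mxE.
  have : (0 : R) <= (tnth t i)%:R by [].
  by case: (sg i) => ? /andP[? ?]; lra.
- rewrite mxE height_comb bk.
  under eq_bigr do rewrite mxE.
  by rewrite -natr_sum -(big_tuple _ _ t xpredT (@nat_of_ord _)) st -natrD subnKC.
Qed.

(** A facet that is kept has coordinate strictly below 1 in the box, which excludes height [d + 1];
    the h-vector therefore ends at index [d]. *)
Lemma box_height b : in_box b -> (exists i, ~~ sg i) ->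
  exists2 k, (k <= d)%N & b 0 0 = k%:R.
Proof.
move=> [bl bb] [i0 si0]; have bp i : 0 <= c b 0 i.
  by have := bb i; rewrite -/(c b); case: (sg i) => /andP[] // /ltW.
have b1 i : c b 0 i <= 1.
  by have := bb i; rewrite -/(c b); case: (sg i) => /andP[] // _ /ltW.
have : 0 <= b 0 0 by rewrite height_coord sumr_ge0.
have : b 0 0 < d.+1%:R.
  have s1 : \sum_(i | i != i0) c b 0 i <= d%:R.
    by rewrite (le_trans (ler_sum _ (fun i _ => b1 i)))// sumr_const cardC1 card_ord.
  have c1 : c b 0 i0 < 1 by have := bb i0; rewrite (negbTE si0) => /andP[].
  by rewrite height_coord (bigD1 i0)//= -natr1; lra.
have /intrP[[k|k] ->] := bl 0; last first.
  by rewrite ler0z.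
by rewrite -[_%:~R]/(k%:R : R) ltr_nat ltnS => kd _; exists k.
Qed.

Lemma ncard_slice n : (exists i, ~~ sg i) ->
  ncard (slice n) = (\sum_(k < d.+1) ncard (box_slice k) * 'C(n + d - k, d))%N.
Proof.
move=> sgN; have gP b : in_box b -> exists k : 'I_d.+1, b 0 0 = k%:R.
  by move=> /box_height/(_ sgN)[k kd ->]; exists (Ordinal (kd : (k < d.+1)%N)).
pose g b : 'I_d.+1 := xget ord0 [set k : 'I_d.+1 | b 0 0 = k%:R].
have gE b : in_box b -> b 0 0 = (g b)%:R.
  by move=> /gP bb; exact: (@xgetPex _ ord0 [set k : 'I_d.+1 | b 0 0 = k%:R]).
rewrite (ncard_fibers (g := frac_part) (finite_slice n) finite_box); last first.
  by move=> x [xl _ _]; exact: frac_part_box.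
have fbk k : finite_set (box_slice k).
  by apply: sub_finite_set finite_box => x [].
transitivity (\sum_(k < d.+1) \sum_(b <- fset_set in_box | g b == k) 'C(n + d - k, d))%N.
  rewrite (exchange_big_dep predT)//= big_seq [RHS]big_seq; apply: eq_bigr => b.
  rewrite in_fset_set ?inE; last exact: finite_box.
  move=> bb; rewrite (ncard_slice_fiber n bb (gE _ bb)); last by rewrite -ltnS.
  by rewrite (big_pred1 (g b))// => k; rewrite eq_sym.
apply: eq_bigr => k _; rewrite big_fset_condE/= big_const_seq count_predT iter_addn addn0.
rewrite mulnC; congr (_ * _)%N; congr #|` _|; apply/fsetP => b.
rewrite in_fset_set// !inE/= in_fset_set; last exact: finite_box.
apply/andP/idP => [[/set_mem bb /eqP <-]|/set_mem[bb bk]].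
  by apply/mem_set; split=> //; exact: gE.
split; first exact/mem_set.
by have /eqP := gE b bb; rewrite bk eqr_nat eq_sym => /eqP/val_inj ->.
Qed.

End SimplicialCone.

(** * Lattice points in cones over polytopes *)

Section BasisEnumeration.
Variables (R : realType) (N D : nat) (A : 'M[R]_(N, D)).

Lemma rowsub_basis n (g : 'I_n -> 'I_N) (S : {set 'I_N}) :
  is_basis A S -> injective g -> (forall i, g i \in S) ->
  (forall j, j \in S -> exists i, j = g i) ->
  [/\ row_free (rowsub g A), row_full (rowsub g A) &
    forall x, (\row_i basis_coord A S x 0 (g i)) *m rowsub g A = x].
Proof.
move=> bS gi gS Sg.
pose L (v : 'rV[R]_n) : 'rV[R]_N := \sum_i v 0 i *: delta_mx 0 (g i).
have LA v : L v *m A = v *m rowsub g A.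
  rewrite mulmx_suml mulmx_sum_row; apply: eq_bigr => i _.
  by rewrite -scalemxAl -rowE row_rowsub.
have Lg v i : L v 0 (g i) = v 0 i.
  rewrite summxE (bigD1 i)//= big1 => [|k ki]; rewrite !mxE eqxx/=.
    by rewrite eqxx mulr1 addr0.
  by rewrite (inj_eq gi) eq_sym (negbTE ki) mulr0.
have sL v : supported S (L v).
  move=> j jS; rewrite summxE big1// => i _; rewrite !mxE eqxx/=.
  by case: eqP => [e|]; [rewrite e gS in jS|rewrite mulr0].
have cx x : (\row_i basis_coord A S x 0 (g i)) *m rowsub g A = x.
  have [sx xA] := coordP x bS; rewrite -LA -[RHS]xA; congr (_ *m _).
  apply/rowP => j; have [jS|jS] := boolP (j \in S).
    by have [i ->] := Sg j jS; rewrite Lg mxE.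
  by rewrite (sL _ _ jS) sx.
split=> //.
  rewrite -kermx_eq0; apply/rowV0P => v /sub_kermxP; rewrite -LA => LA0.
  have L0 := bS.1 _ (sL v) LA0.
  by apply/rowP => i; rewrite -Lg L0 !mxE.
by rewrite -sub1mx; apply/row_subP => i; rewrite -(cx (row i 1%:M)) submxMl.
Qed.

(** Turns a subset basis into the square invertible matrix that the analysis of a single simplicial
    cone works with. *)
Lemma basis_enum (S : {set 'I_N}) : is_basis A S ->
  exists g : 'I_D -> 'I_N, [/\ injective g, forall i, g i \in S,
    rowsub g A \in unitmx &
    forall x i, (x *m invmx (rowsub g A)) 0 i = basis_coord A S x 0 (g i)].
Proof.
move=> bS; have := @rowsub_basis #|S| enum_val S bS enum_val_inj (@enum_valP _ _).
move=> []; first by move=> j jS; exists (enum_rank_in jS j); rewrite enum_rankK_in.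
move=> /eqP rf /eqP rF _; have e : D = #|S| by rewrite -rf rF.
have gi : injective (fun i : 'I_D => enum_val (cast_ord e i)).
  by move=> i j /enum_val_inj/cast_ord_inj.
have gS (i : 'I_D) : enum_val (cast_ord e i) \in S by exact: enum_valP.
have [|rf' _ cx] := rowsub_basis bS gi gS.
  move=> j jS; exists (cast_ord (esym e) (enum_rank_in jS j)).
  by rewrite cast_ordKV enum_rankK_in.
exists (fun i => enum_val (cast_ord e i)); split=> //; first by rewrite -row_free_unit.
move=> x i; rewrite -[in LHS](cx x) mulmxK ?mxE//; by rewrite -row_free_unit.
Qed.

End BasisEnumeration.

(** * The h-vector of a cone *)

Section ConeCount.
Variables (R : realType) (N d : nat) (A : 'M[R]_(N, d.+1)).
Implicit Types (x : 'rV[R]_d.+1).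

Definition cone_slice (n : nat) := [set x | [/\ lattice x, x 0 0 = n%:R &
  exists2 l : 'rV[R]_N, nonneg_vec l & l *m A = x]].

(** For generators at height 1: they are distinct and each is a vertex of their convex hull. *)
Definition irredundant := forall i (l : 'rV[R]_N), nonneg_vec l ->
  l *m A = row i A -> l 0 i = 1.

Hypotheses (Aspan : forall v, exists l : 'rV_N, l *m A = v)
  (Al : forall i, lattice (row i A)) (Ah : forall i, A i 0 = 1).

Lemma height_cone (l : 'rV[R]_N) : (l *m A) 0 0 = \sum_i l 0 i.
Proof. by rewrite mxE; apply: eq_bigr => i _; rewrite Ah mulr1. Qed.

Lemma finite_cone_slice n : finite_set (cone_slice n).
Proof.
apply: sub_finite_set (finite_lattice_comb A n%:R) => x [xl xn [l lp xE]].
split=> //; exists l; split=> // i; rewrite ger0_norm// -xn -xE height_cone.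
by rewrite (bigD1 i)//= lerDl sumr_ge0.
Qed.

Lemma ncard_cone_slice0 : ncard (cone_slice 0) = 1%N.
Proof.
rewrite (_ : cone_slice 0 = [set 0]) ?/ncard ?fset_set1 ?cardfs1//.
apply/seteqP; split=> x /=; last first.
  move=> ->; split; first by move=> j; rewrite mxE.
    by rewrite mxE.
  by exists 0; [move=> i; rewrite mxE|rewrite mul0mx].
move=> [_ x0 [l lp lA]]; rewrite -lA (_ : l = 0) ?mul0mx//.
apply/rowP => i; rewrite mxE; move: x0; rewrite -lA height_cone => /eqP.
by rewrite psumr_eq0// => /allP/(_ i (mem_index_enum _))/eqP.
Qed.

Lemma htA : A *m delta_mx 0 0 = const_mx 1 :> 'cV[R]_N.
Proof.
apply/matrixP => i j; rewrite !mxE (bigD1 0)//= big1 => [|k k0].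
  by rewrite !mxE !ord1 !eqxx Ah/= mulr1 addr0.
by rewrite !mxE (negbTE k0) mulr0.
Qed.

Lemma coordN S x : is_basis A S -> basis_coord A S (- x) = - basis_coord A S x.
Proof.
move=> bS; have := coordDZ 0 (-1) x bS.
have -> : basis_coord A S 0 = 0.
  by rewrite -[in LHS](mul0mx 1 A) coord_unique// => i _; rewrite mxE.
by rewrite !add0r !scaleN1r.
Qed.

Lemma genericN y : generic A y -> generic A (- y).
Proof. by move=> gy S i bS iS; rewrite coordN// mxE oppr_eq0 gy. Qed.

Section Cell.
Variables (S : {set 'I_N}) (g : 'I_d.+1 -> 'I_N).
Hypotheses (bS : is_basis A S) (gS : forall i, g i \in S)
  (Bu : rowsub g A \in unitmx)
  (cg : forall x i, (x *m invmx (rowsub g A)) 0 i = basis_coord A S x 0 (g i)).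

(** A generator missed by [g] would have zero coordinates, hence height 0 instead of 1. *)
Lemma cell_enum_surj j : j \in S -> exists i, j = g i.
Proof.
move=> jS; apply: contrapT => /forallNP nj.
have := coord_row bS jS; set v := row j A => cv.
have : v *m invmx (rowsub g A) = 0.
  by apply/rowP => i; rewrite cg cv !mxE eqxx/=; case: eqP => // e; case: (nj i).
move=> /(congr1 (fun u => u *m rowsub g A)); rewrite mulmxKV// mul0mx.
move=> /(congr1 (fun u : 'rV[R]_d.+1 => u 0 0))/eqP.
by rewrite /v !mxE Ah oner_eq0.
Qed.

Lemma cell_in_half_open y x : half_open A y S x <->
  in_half_open (rowsub g A) (fun i => basis_coord A S y 0 (g i) < 0) x.
Proof.
split=> h i; first by rewrite cg; exact: h.
by move=> /cell_enum_surj[k ->]; have := h k; rewrite cg.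
Qed.

Lemma cell_row_lattice i : lattice (row i (rowsub g A)).
Proof. by rewrite row_rowsub. Qed.

Lemma cell_row_height i : rowsub g A i 0 = 1.
Proof. by rewrite mxE. Qed.

(** The coordinates of the interior direction add up to its positive height, so one of them is
    nonnegative and its facet is kept, as [box_height] requires. *)
Lemma cell_not_all_open (l0 : 'rV_N) : (forall i, 0 < l0 0 i) ->
  exists i, ~~ (basis_coord A S (l0 *m A) 0 (g i) < 0).
Proof.
move=> l0p; apply: contrapT => /forallNP neg.
have := height_coord Bu cell_row_height (l0 *m A).
have s1 : 0 < (l0 *m A) 0 0.
  rewrite height_cone (bigD1 (g 0))//= ltr_wpDr// sumr_ge0// => i _; exact/ltW.
move=> e; move: s1; rewrite e ltNge => /negP; apply.
apply: sumr_le0 => i _; rewrite cg; apply/ltW.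
by have := neg i => /negP; rewrite negbK.
Qed.

Lemma cell_slice y n :
  [set x | cone_slice n x /\ half_open A y S x] =
  slice (rowsub g A) (fun i => basis_coord A S y 0 (g i) < 0) n.
Proof.
apply/seteqP; split=> x.
  by move=> [[xl xn _] /cell_in_half_open].
move=> [xl /cell_in_half_open xh xn]; split=> //; split=> //.
exists (basis_coord A S x); first exact: half_open_cone xh.
by have [] := coordP x bS.
Qed.

(* Reflection in the centre of the box exchanges closed and open facets, hence y
   and -y. *)
Lemma cell_top_box y : generic A y ->
  (ncard (box_slice (rowsub g A) (fun i => (basis_coord A S y 0 (g i) < 0)%R) d) <=
   ncard [set x | cone_slice 1 x /\ half_open A (- y) S x])%N.
Proof.
(* Twice the centre of the box, at height [d + 1]: reflection takes height [d] to height 1. *)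
move=> gy; pose s := \sum_i row i (rowsub g A); set X := box_slice _ _ _.
have fX : finite_set X.
  apply: sub_finite_set (finite_box (fun i => basis_coord A S y 0 (g i) < 0) Bu) => x. by case.
have fi : {in X &, injective (fun b => s - b)}.
  by move=> b b' _ _ /addrI/oppr_inj.
rewrite -(ncard_image fX fi); apply: ncard_le.
  by apply: sub_finite_set (finite_cone_slice 1) => x [].
move=> _ [b [[bl bb] bd] <-].
have sE : s = const_mx 1 *m rowsub g A.
  by rewrite mulmx_sum_row; apply: eq_bigr => i _; rewrite mxE scale1r.
have sl : lattice s.
  by move=> j; rewrite summxE rpred_sum// => i _; exact: cell_row_lattice.
have ch i : basis_coord A S (s - b) 0 (g i) = 1 - basis_coord A S b 0 (g i).
  by rewrite -!cg mulmxBl sE mulmxK// !mxE.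
have ho : half_open A (- y) S (s - b).
  move=> j jS; have [i ij] := cell_enum_surj jS.
  rewrite ij coordN// mxE ch oppr_lt0; have := bb i; rewrite cg.
  have := gy S (g i) bS (gS i).
  by case: ltgtP => //= _ _ /andP[? ?]; rewrite ?subr_gt0 ?subr_ge0.
split=> //; split; first exact: latticeB.
  rewrite mxE [X in _ + X]mxE bd sE (height_comb cell_row_height).
  under eq_bigr do rewrite mxE.
  by rewrite sumr_const card_ord; apply/eqP; rewrite subr_eq addrC natr1.
by exists (basis_coord A S (s - b)); [exact: half_open_cone ho|have [] := coordP (s - b) bS].
Qed.

End Cell.

Theorem cone_count : exists h : nat -> nat, [/\ h 0%N = 1%N,
  forall n, ncard (cone_slice n) = (\sum_(k < d.+1) h k * 'C(n + d - k, d))%N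
  & (0 < d)%N -> irredundant -> (h d <= h 1)%N].
Proof.
have [T [l0 [l0p gy bT exT unT]]] := half_open_decomposition Aspan htA.
set y := l0 *m A in gy exT.
have [S0 [_ bS0]] : exists S' : {set 'I_N}, finset.set0 \subset S' /\ is_basis A S'.
  apply: indep_extend => // l sl _; apply/rowP => i; rewrite mxE sl//.
  by rewrite finset.in_set0.
have [g0 [g0i _ _ _]] := basis_enum bS0.
have leDN : (d.+1 <= N)%N by have := leq_card _ g0i; rewrite !card_ord.
have : forall S, exists g : 'I_d.+1 -> 'I_N, is_basis A S -> [/\ injective g,
    forall i, g i \in S, rowsub g A \in unitmx &
    forall x i, (x *m invmx (rowsub g A)) 0 i = basis_coord A S x 0 (g i)].
  move=> S; have [/basis_enum[g gP]|nb] := pselect (is_basis A S).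
    by exists g.
  by exists g0.
move=> /choice[F FP].
pose sg S i := basis_coord A S y 0 (F S i) < 0.
pose h k := (\sum_(S in T) ncard (box_slice (rowsub (F S) A) (sg S) k))%N.
pose cellof x := xget finset.set0 [set S | S \in T /\ half_open A y S x].
have cellofP x n : cone_slice n x -> cellof x \in T /\ half_open A y (cellof x) x.
  move=> [_ _ [l lp <-]]; have [S ST hS] := exT l lp.
  by apply: (@xgetPex _ _ [set S | S \in T /\ half_open A y S (l *m A)]); exists S.
have cellofE x n S : S \in T -> cone_slice n x -> cellof x = S <-> half_open A y S x.
  move=> ST xn; have [cT hc] := cellofP x n xn; split=> [<- //|hS].
  exact: (unT y gy _ _ x).
have count n : ncard (cone_slice n) = (\sum_(k < d.+1) h k * 'C(n + d - k, d))%N.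
  rewrite (ncard_fin cellof (finite_cone_slice n)).
  rewrite (bigID (mem T))/= [X in (_ + X)%N]big1 ?addn0; last first.
    move=> S ST; apply: ncard_eq0 => x [xn xS]; move: ST.
    by rewrite -xS; have [-> _] := cellofP x n xn.
  transitivity (\sum_(S in T) \sum_(k < d.+1)
      ncard (box_slice (rowsub (F S) A) (sg S) k) * 'C(n + d - k, d))%N.
    apply: eq_bigr => S ST; have bS := bT S ST; have [gi gS Bu cg] := FP S bS.
    rewrite -ncard_slice//.
    - rewrite -(cell_slice bS) //; congr ncard; apply/seteqP; split=> x [xn xS];
        split=> //; exact/(cellofE x n S ST xn).
    - by move=> i; rewrite row_rowsub.
    - by move=> i; rewrite mxE.
    - exact: cell_not_all_open.
  by rewrite exchange_big/=; apply: eq_bigr => k _; rewrite big_distrl.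
have h0 : h 0%N = 1%N.
  (* At [n = 0] only the index 0 contributes, and the cone has the origin alone at height 0. *)
  have := count 0%N; rewrite ncard_cone_slice0 big_ord_recl/= add0n subn0 binn muln1.
  by rewrite big1 ?addn0// => k _; rewrite bin_small ?muln0//= /bump; have := ltn_ord k; lia.
exists h; split=> // d0 irr.
have h1 : ncard (cone_slice 1) = (d.+1 + h 1%N)%N.
  rewrite count big_ord_recl h0 mul1n/= subn0 add1n binSn.
  rewrite (bigD1 (Ordinal d0))//= /bump/= addn0 subSS subn0 binn muln1.
  rewrite big1 ?addn0// => k k0; rewrite bin_small ?muln0// add1n subSS.
  by case: k k0 => -[|k]//= kd _; lia.
rewrite -(leq_add2l d.+1) -h1; apply: (@leq_trans (N + h d)); first by rewrite leq_add2r.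
(* Sorts the points of height 1 by their cell for [- y]. The value [None] is left for points in no
   such cell; the generators are among these. *)
pose g (x : 'rV[R]_d.+1) : option {set 'I_N} :=
  xget None [set o | exists2 S, o = Some S & S \in T /\ half_open A (- y) S x].
rewrite (ncard_fin g (finite_cone_slice 1)) (bigD1 None)//=.
apply: leq_add.
  rewrite -[X in (X <= _)%N](card_ord N) -cardsT.
  rewrite -(@ncard_finType _ _ _ (fun i => row i A)); last first.
    move=> i j _ _ ij; have := irr i (delta_mx 0 j); rewrite -rowE -ij.
    rewrite mxE eqxx/=; case: eqP => // _ /(_ _ erefl).
    move=> e; suff /e/eqP : nonneg_vec (delta_mx 0 j : 'rV[R]_N) by rewrite eq_sym oner_eq0.
    by move=> k; rewrite mxE.
  apply: ncard_le; first by apply: sub_finite_set (finite_cone_slice 1) => x [].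
  move=> _ [i _ <-]; split.
    split=> //; first by rewrite mxE.
    exists (delta_mx 0 i); last by rewrite -rowE.
    by move=> k; rewrite mxE.
  rewrite /g; case: xgetP => // o _ [S _ [ST hS]].
  have bS := bT S ST; have [e [e0 _ eP]] := perturbation (row i A) (genericN gy).
  (* [row i A] would be a positive combination of all generators. *)
  have pos := (eP S bS).1 hS; set v := row i A + e *: - y in pos.
  have [sv vA] := coordP v bS.
  pose l := basis_coord A S v + e *: l0.
  have lA : l *m A = row i A.
    by rewrite mulmxDl vA -scalemxAl /v scalerN subrK.
  have lp k : 0 < l 0 k.
    rewrite !mxE ltr_wpDl ?mulr_gt0//; have [/pos/ltW//|/sv ->//] := boolP (k \in S).
  have li : l 0 i = 1 by apply: irr => // k; exact/ltW.
  have := height_cone l; rewrite lA mxE Ah (bigD1 i)//= li => /eqP.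
  rewrite -[X in X == _]addr0 (inj_eq (addrI _)) eq_sym psumr_eq0 => [/allP z|k _]; last exact/ltW.
  have [j ij] : exists j : 'I_N, j != i.
    have [e0i|] := eqVneq (g0 ord0) i; last by move=> ?; exists (g0 ord0).
    exists (g0 (Ordinal (d0 : (1 < d.+1)%N))).
    by rewrite -e0i (inj_eq g0i).
  by have := z j (mem_index_enum _); rewrite ij/= gt_eqF.
rewrite (reindex_omap Some id)/=; last by case.
rewrite (eq_bigl xpredT); last by move=> S; rewrite eqxx.
rewrite /h big_mkcond/=; apply: leq_sum => S _; case: ifP => // ST.
have bS := bT S ST; have [gi gS Bu cg] := FP S bS.
rewrite (leq_trans (cell_top_box bS gS Bu cg gy))//; apply: ncard_le.
  by apply: sub_finite_set (finite_cone_slice 1) => x [].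
move=> x [x1 hx]; split=> //; rewrite /g; case: xgetP => [u _ [S1 -> [S1T hS1]]|].
  by congr Some; exact: (unT (- y) (genericN gy) S1 S x).
by move=> /(_ (Some S)) []; exists S.
Qed.

End ConeCount.

(** * Homogenization of polytopes *)

Section Homogenization.
Variables (R : realType) (d : nat).
Implicit Types (x y : 'rV[R]_d) (u v : 'rV[R]_d.+1).

Definition at_height (r : R) x : 'rV[R]_d.+1 :=
  \row_j (if unlift ord0 j is Some k then x 0 k else r).
Definition base_part v : 'rV[R]_d := \row_j v 0 (lift ord0 j).

Lemma at_height0 r x : at_height r x 0 0 = r.
Proof. by rewrite mxE unlift_none. Qed.

Lemma at_heightS r x j : at_height r x 0 (lift ord0 j) = x 0 j.
Proof. by rewrite mxE liftK. Qed.

Lemma eq_at_height v r x :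
  v 0 0 = r -> (forall j, v 0 (lift ord0 j) = x 0 j) -> v = at_height r x.
Proof.
move=> v0 vS; apply/rowP => j; case: (unliftP ord0 j) => [k ->|->].
  by rewrite at_heightS vS.
by rewrite at_height0.
Qed.

Lemma at_heightK r : cancel (at_height r) base_part.
Proof. by move=> x; apply/rowP => j; rewrite mxE at_heightS. Qed.

Lemma base_partK v : at_height (v 0 0) (base_part v) = v.
Proof. by apply/esym/eq_at_height => // j; rewrite mxE. Qed.

Lemma lattice_at_height (n : nat) x : lattice (at_height n%:R x) <-> lattice x.
Proof.
split=> xl j; first by have := xl (lift ord0 j); rewrite at_heightS.
case: (unliftP ord0 j) => [k ->|->]; first by rewrite at_heightS.
by rewrite at_height0 natr_int.
Qed.

Variables (N : nat) (V : 'M[R]_(N, d)).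

Definition polytope : set 'rV[R]_d := conv_hull [set row i V | i in [set: 'I_N]].

Definition cone_mx : 'M[R]_(N, d.+1) :=
  \matrix_(i, j) (if unlift ord0 j is Some k then V i k else 1).

Lemma cone_mx0 i : cone_mx i 0 = 1.
Proof. by rewrite mxE unlift_none. Qed.

Lemma cone_mxS i j : cone_mx i (lift ord0 j) = V i j.
Proof. by rewrite mxE liftK. Qed.

Lemma mul_cone_mx (l : 'rV[R]_N) :
  l *m cone_mx = at_height (\sum_i l 0 i) (l *m V).
Proof.
apply: eq_at_height; first by rewrite height_cone//; exact: cone_mx0.
by move=> j; rewrite !mxE; apply: eq_bigr => i _; rewrite cone_mxS.
Qed.

Lemma row_cone_mx i : row i cone_mx = at_height 1 (row i V).
Proof. by apply: eq_at_height; [rewrite mxE cone_mx0|move=> j; rewrite !mxE liftK]. Qed.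

Lemma polytopeP x : polytope x <->
  exists l : 'rV_N, [/\ nonneg_vec l, \sum_i l 0 i = 1 & x = l *m V].
Proof.
split=> [[n [p [w [pV w0 w1 ->]]]]|[l [l0 l1 ->]]]; last first.
  exists N, (fun i => row i V), (l 0); split=> //; last by rewrite mulmx_sum_row.
have /choice[f fP] : forall i, exists j, row j V = p i.
  by move=> i; have [j _ <-] := pV i; exists j.
exists (\sum_i w i *: delta_mx 0 (f i)); split.
- move=> j; rewrite summxE sumr_ge0// => i _; rewrite !mxE mulr_ge0//.
- rewrite -[RHS]w1; under eq_bigr do rewrite summxE.
  rewrite exchange_big/=; apply: eq_bigr => i _.
  rewrite (bigD1 (f i))//= big1 => [|k ki]; rewrite !mxE eqxx/=.
    by rewrite eqxx mulr1 addr0.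
  by rewrite (negbTE ki) mulr0.
- rewrite mulmx_suml; apply: eq_bigr => i _.
  by rewrite -scalemxAl -rowE fP.
Qed.

Lemma polytope_cone x : polytope x <->
  exists2 l : 'rV_N, nonneg_vec l & l *m cone_mx = at_height 1 x.
Proof.
rewrite polytopeP; split=> [[l [l0 l1 ->]]|[l l0 lx]].
  by exists l => //; rewrite mul_cone_mx l1.
exists l; move: lx; rewrite mul_cone_mx => lx; split=> //.
  by have := congr1 (fun v : 'rV_d.+1 => v 0 0) lx; rewrite !at_height0.
by have := congr1 base_part lx; rewrite !at_heightK.
Qed.

Lemma dilate_cone n x : (0 < n)%N -> dilate n polytope x <->
  exists2 l : 'rV_N, nonneg_vec l & l *m cone_mx = at_height n%:R x.
Proof.
move=> n0; have nR : n%:R != 0 :> R by rewrite pnatr_eq0 -lt0n.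
split=> [[y /polytopeP[l [l0 l1 ->]] <-]|[l l0 lx]].
  exists (n%:R *: l); first by move=> i; rewrite mxE mulr_ge0.
  rewrite mul_cone_mx -scalemxAl; congr at_height.
  by under eq_bigr do rewrite mxE; rewrite -mulr_sumr l1 mulr1.
exists (n%:R^-1 *: x); last by rewrite scalerA divff// scale1r.
apply/polytopeP; exists (n%:R^-1 *: l); move: lx; rewrite mul_cone_mx => lx.
have sl : \sum_i l 0 i = n%:R.
  by have := congr1 (fun v : 'rV_d.+1 => v 0 0) lx; rewrite !at_height0.
have lV : l *m V = x by have := congr1 base_part lx; rewrite !at_heightK.
split; first by move=> i; rewrite mxE mulr_ge0.
  by under eq_bigr do rewrite mxE; rewrite -mulr_sumr sl mulVf.
by rewrite -scalemxAl lV.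
Qed.

Lemma at_height_dilate n : (0 < n)%N ->
  [set at_height n%:R x | x in dilate n polytope `&` lattice] = cone_slice cone_mx n.
Proof.
move=> n0.
apply/seteqP; split=> [_ [x [/(dilate_cone _ n0)[l l0 lx] xl] <-]|v [vl v0 [l l0 lv]]].
  by split; [exact/lattice_at_height|exact: at_height0|exists l].
exists (base_part v); last by rewrite -v0 base_partK.
split; last by move=> j; rewrite mxE.
by apply/(dilate_cone _ n0); exists l => //; rewrite -v0 base_partK.
Qed.

Lemma finite_dilate n : (0 < n)%N -> finite_set (dilate n polytope `&` lattice).
Proof.
move=> n0; have fC : finite_set (cone_slice cone_mx n).
  by apply: finite_cone_slice => i; exact: cone_mx0.
apply: sub_finite_set (finite_image base_part fC) => x xP.
exists (at_height n%:R x); last exact: at_heightK.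
by rewrite -at_height_dilate//; exists x.
Qed.

Lemma lattice_count_cone n : (0 < n)%N ->
  lattice_count polytope n = ncard (cone_slice cone_mx n).
Proof.
move=> n0; rewrite -[LHS]/(ncard _) -at_height_dilate// ncard_image//.
  exact: finite_dilate.
by move=> x y _ _; exact: (can_inj (at_heightK _)).
Qed.

Lemma cone_mx_lattice : (forall i, lattice (row i V)) ->
  forall i, lattice (row i cone_mx).
Proof. by move=> Vl i; rewrite row_cone_mx; exact/(lattice_at_height 1). Qed.

End Homogenization.

(** * Volume *)

Section PolynomialLimits.
Variable R : realType.

(** The limit [n] to infinity for polynomials in 1/n: on [0, 1] a polynomial exceeds its value at 0
    by at most [t * M], with [M] the sum of the absolute values of its coefficients. *)
Lemma le_poly_at0 (p q : {poly R}) (n0 : nat) :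
  (forall n, (n0 < n)%N -> p.[n%:R^-1] <= q.[n%:R^-1]) -> p.[0] <= q.[0].
Proof.
move=> pq; rewrite -subr_ge0 leNgt; apply/negP; set r := q - p.
have -> : q.[0] - p.[0] = r.[0] by rewrite hornerD hornerN.
move=> r0; pose M := \sum_(i < size r) `|r`_i|.
have rM t : 0 <= t <= 1 -> r.[t] <= r.[0] + t * M.
  move=> /andP[t0 t1]; rewrite -lerBlDl !horner_coef -sumrB mulr_sumr.
  apply: ler_sum => i _; case: (nat_of_ord i) => [|k].
    by rewrite !expr0 subrr mulr_ge0.
  rewrite expr0n/= mulr0 subr0 (le_trans (ler_norm _))// normrM (ger0_norm (exprn_ge0 _ t0)).
  by rewrite mulrC ler_wpM2r// exprS ler_piMr// exprn_ile1.
pose n := maxn n0.+1 (Num.bound (M / - r.[0])).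
have n0n : (n0 < n)%N by rewrite /n; lia.
have nR : 0 < n%:R :> R by rewrite ltr0n (leq_ltn_trans _ n0n).
have M0 : 0 <= M by apply: sumr_ge0.
have Mn : M < - r.[0] * n%:R.
  rewrite mulrC -ltr_pdivrMr ?oppr_gt0//.
  apply: lt_le_trans (archi_boundP (divr_ge0 M0 _)) _; first by rewrite oppr_ge0 ltW.
  by rewrite ler_nat leq_maxr.
have : 0 <= r.[n%:R^-1] by rewrite hornerD hornerN subr_ge0 pq.
have := rM n%:R^-1; rewrite invr_ge0 ltW//= invf_le1// ler1n -(ltr0n R) nR.
move=> /(_ isT) h h0; have := le_trans h0 h; apply/negP; rewrite -ltNge.
by rewrite -ltrBrDl sub0r mulrC ltr_pdivrMr.
Qed.

Lemma box_cover_sum (M : nat) (u : nat -> R) : (forall k, 0 <= u k) ->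
  (forall k, (M <= k)%N -> u k = 0) ->
  (\sum_(0 <= k <oo) (u k)%:E)%E = (\sum_(k < M) u k)%:E.
Proof.
move=> u0 uM; rewrite (nneseries_split 0 M)//; last by move=> k _; rewrite lee_fin.
rewrite add0n (@eseries0 _ _ M) ?adde0; last by move=> k Mk _; rewrite uM.
by rewrite big_mkord sumEFin.
Qed.

Lemma ffact_leq_expn (n d : nat) : (n ^_ d <= n ^ d)%N.
Proof.
rewrite ffact_prod -[X in (_ <= _ ^ X)%N](card_ord d) -prod_nat_const.
by apply: leq_prod => i _; rewrite leq_subr.
Qed.

(** With [ffact_leq_expn] this makes every ['C(n + d - k, d)] grow like n^d/d!, so that the volume
    sees only the sum of the h-vector. *)
Lemma expn_leq_ffact (n d k : nat) : (k <= d)%N -> ((n - d) ^ d <= (n + d - k) ^_ d)%N.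
Proof.
move=> kd; rewrite ffact_prod -[X in (_ ^ X <= _)%N](card_ord d) -prod_nat_const.
by apply: leq_prod => i _; have := ltn_ord i; lia.
Qed.

End PolynomialLimits.

Section LatticeBoxes.
Variables (R : realType) (d : nat).

Lemma ncard_cover (T : choiceType) (I : finType) (X : set T) (Y : I -> set T) :
  finite_set X -> (forall i, finite_set (Y i)) ->
  (forall x, X x -> exists i, Y i x) -> (ncard X <= \sum_i ncard (Y i))%N.
Proof.
move=> fX fY XY; have [[x0 /XY[i0 _]]|X0] := pselect (X !=set0); last first.
  by rewrite ncard_eq0// => x Xx; apply: X0; exists x.
pose g x := xget i0 [set i | Y i x].
rewrite (ncard_fin g fX); apply: leq_sum => i _; apply: ncard_le => // x [Xx <-].
by apply: (@xgetPex _ i0 [set i | Y i x]); exact: XY.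
Qed.

(** Per coordinate, an interval contains at most one integer more than the floor of its length,
    counted from the ceiling of its left end. *)
Lemma lattice_box_count (a b : 'rV[R]_d) : (forall j, a 0 j <= b 0 j) ->
  finite_set (lattice `&` box a b) /\
  (ncard (lattice `&` box a b))%:R <= \prod_j (b 0 j - a 0 j + 1) :> R.
Proof.
move=> ab; pose m j := `|Num.floor (b 0 j - a 0 j)%R|%N.+1.
have mE j : (m j)%:R <= b 0 j - a 0 j + 1.
  rewrite /m -natr1 lerD2r -[_%:R]/((_%:Z)%:~R : R) gez0_abs ?ge_floor//.
  by rewrite floor_ge0 subr_ge0.
pose f (g : {dffun forall j : 'I_d, 'I_(m j)}) : 'rV[R]_d :=
  \row_j ((Num.ceil (a 0 j))%:~R + (g j : nat)%:R).
have sub : lattice `&` box a b `<=`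
    [set f g | g in [set` [set: {dffun forall j : 'I_d, 'I_(m j)}]%SET]].
  move=> x [xl xb].
  have zP j : exists k : 'I_(m j), x 0 j = (Num.ceil (a 0 j))%:~R + (k : nat)%:R.
    have /andP[ax xb'] := xb j; have /intrP[z xz] := xl j.
    have az : Num.ceil (a 0 j) <= z by rewrite ceil_le_int -xz.
    have zb : z - Num.ceil (a 0 j) <= Num.floor (b 0 j - a 0 j).
      by rewrite floor_ge_int intrB -xz lerB// ceil_ge.
    have km : (`|(z - Num.ceil (a 0 j))%R|%N < m j)%N by rewrite /m; move: az zb; clear; lia.
    exists (Ordinal km); rewrite /= -[_%:R]/((_%:Z)%:~R : R) gez0_abs ?subr_ge0//.
    by rewrite intrB addrC subrK.
  exists [ffun j => sval (cid (zP j))]; first by rewrite /= finset.in_setT.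
  by apply/rowP => j; rewrite mxE ffunE; case: cid.
have fF : finite_set [set f g | g in [set` [set: {dffun forall j : 'I_d, 'I_(m j)}]%SET]].
  by apply: finite_image; exact: finite_finpred.
split; first exact: sub_finite_set fF.
apply: (@le_trans _ _ (\prod_j (m j)%:R)); last first.
  by apply: ler_prod => j _; rewrite mE andbT.
rewrite -natr_prod ler_nat (leq_trans (ncard_le fF sub))// ncard_finType.
  rewrite cardsT card_dep_ffun foldrE big_image/=.
  by under eq_bigr do rewrite card_ord.
move=> g g' _ _ /rowP gg; apply/ffunP => j; apply: val_inj.
by have := gg j; rewrite !mxE => /addrI/eqP; rewrite eqr_nat => /eqP.
Qed.

End LatticeBoxes.

Section Compactness.
Variables (R : realType).

Lemma mulmx_continuous N d (V : 'M[R]_(N, d)) :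
  continuous (fun l : 'rV[R]_N => l *m V).
Proof.
move=> l t [P Pn Pt].
apply: (@filterS _ _ _ (fun l' => forall ij : 'I_1 * 'I_d, P ij.1 ij.2 ((l' *m V) ij.1 ij.2))).
  by move=> l' h; apply: Pt => i j; exact: (h (i, j)).
have near_entry (ij : 'I_1 * 'I_d) :
    nbhs l [set l' : 'rV[R]_N | P ij.1 ij.2 ((l' *m V) ij.1 ij.2)].
  case: ij => i j /=.
  suff : (fun l' : 'rV[R]_N => (l' *m V) i j) @ l --> (l *m V) i j by apply; exact: Pn.
  rewrite [X in _ --> X]mxE; under eq_fun do rewrite mxE.
  apply: cvg_big.
  - by move=> x; exact: add_continuous.
  - exact: nbhs_filter.
  - by move=> k _; apply: cvgMr_tmp; [exact: nbhs_filter|exact: coord_continuous].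
exact: (@filter_forall _ _ _ _ (nbhs_filter _) near_entry).
Qed.

Lemma polytope_compact N d (V : 'M[R]_(N, d)) : compact (polytope V).
Proof.
pose D := [set l : 'rV[R]_N | nonneg_vec l /\ \sum_i l 0 i = 1].
have -> : polytope V = [set l *m V | l in D].
  apply/seteqP; split=> x; first by move/polytopeP=> [l [l0 l1 ->]]; exists l.
  by move=> [l [l0 l1] <-]; apply/polytopeP; exists l.
apply: continuous_compact; first by apply: continuous_subspaceT; exact: mulmx_continuous.
have cube : compact [set l : 'rV[R]_N | forall i, `[0 : R, 1]%classic (l ord0 i)].
  by apply: (@rV_compact R N (fun=> `[0 : R, 1]%classic)) => _; exact: segment_compact.
(* The coordinate sum as a matrix product, so that [mulmx_continuous] applies. *)
pose s (l : 'rV[R]_N) := (l *m (const_mx 1 : 'cV[R]_N)) 0 0.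
have sE l : s l = \sum_i l 0 i.
  by rewrite /s mxE; apply: eq_bigr => i _; rewrite mxE mulr1.
have sc : continuous s.
  move=> l; apply: (@continuous_comp 'rV[R]_N 'rV[R]_1 R
    (fun l => l *m (const_mx 1 : 'cV[R]_N)) (fun M => M 0 0)).
    exact: mulmx_continuous.
  exact: coord_continuous.
have cD : closed [set l | s l = 1].
  by apply: (@preimage_closed _ _ s [set 1]); [move=> l _; exact: sc|exact: closed_eq].
have -> : D = [set l | s l = 1] `&` [set l : 'rV[R]_N | forall i, `[0 : R, 1]%classic (l ord0 i)].
  apply/seteqP; split=> l [].
    move=> l0 l1; split; first by rewrite /= sE.
    move=> i; rewrite /= in_itv/= l0 /= -l1 (bigD1 i)//= lerDl.
    by apply: sumr_ge0 => j _; exact: l0.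
  move=> /=; rewrite sE => l1 l01; split=> // i.
  by have := l01 i; rewrite /= in_itv/= => /andP[].
by rewrite setIC; exact: compact_closedI.
Qed.

End Compactness.

(** * Lower bound for the outer measure *)

Section OuterMeasure.
Variables (R : realType) (d : nat).
Implicit Types (a b : 'rV[R]_d).

Lemma box_volume_ge0 a b : (forall j, a 0 j <= b 0 j) -> 0 <= box_volume a b.
Proof. by move=> ab; apply: prodr_ge0 => j _; rewrite subr_ge0. Qed.

(** The enlarged volume is a polynomial in [t]; if every 1/n failed, [le_poly_at0] would compare the
    values at 0 the wrong way round. *)
Lemma box_enlarge a b e : (forall j, a 0 j <= b 0 j) -> 0 < e -> exists2 t : R, 0 < t &
  box_volume (a - const_mx t) (b + const_mx t) <= box_volume a b + e.
Proof.
move=> ab e0; apply: contrapT => no.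
pose q : {poly R} := \prod_j ((b 0 j - a 0 j)%:P + 2%:R *: 'X).
have qE t : q.[t] = box_volume (a - const_mx t) (b + const_mx t).
  rewrite horner_prod; apply: eq_bigr => j _.
  by rewrite !mxE hornerD hornerC hornerZ hornerX; lra.
have := @le_poly_at0 R (box_volume a b + e)%:P q 0.
rewrite hornerC qE /= => /(_ _)/wrap[n n0|].
  rewrite hornerC qE; apply/ltW; rewrite ltNge; apply/negP => h; apply: no.
  by exists n%:R^-1 => //; rewrite invr_gt0 ltr0n.
apply/negP; rewrite -ltNge (_ : const_mx 0 = 0)// subr0 addr0 ltrDl//.
Qed.

Lemma box_interior a b t : 0 < t ->
  box a b `<=` (box (a - const_mx t) (b + const_mx t))°.
Proof.
move=> t0 x xb; exists (fun i j => ball (x i j) t).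
  by move=> i j; exact: nbhsx_ballx.
move=> y /= xy j; have /andP[ax bx] := xb j; have := xy 0 j.
by rewrite /ball/= !mxE ltr_distl => /andP[? ?]; apply/andP; split; lra.
Qed.

Variables (N : nat) (V : 'M[R]_(N, d)) (v0 : R).
Let L n := ncard (cone_slice (cone_mx V) n).

Lemma finite_cover_volume (M : nat) (a b : 'I_M -> 'rV[R]_d) :
  (forall n, (d < n)%N -> v0 * (n - d)%:R ^+ d <= (L n)%:R) ->
  (forall k j, a k 0 j <= b k 0 j) ->
  (forall x, polytope V x -> exists k, box (a k) (b k) x) ->
  v0 <= \sum_k box_volume (a k) (b k).
Proof.
move=> low ab cov.
(* The polynomials [p] and [q] are the lower bound on the lattice count and the total bound from the
   boxes, both divided by n^d and written in 1/n. *)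
pose p : {poly R} := v0 *: (1 - d%:R *: 'X) ^+ d.
pose q : {poly R} := \sum_k \prod_j ((b k 0 j - a k 0 j)%:P + 'X).
have qE t : q.[t] = \sum_k \prod_j (b k 0 j - a k 0 j + t).
  rewrite horner_sum; apply: eq_bigr => k _; rewrite horner_prod; apply: eq_bigr => j _.
  by rewrite hornerD hornerC hornerX.
have pE t : p.[t] = v0 * (1 - d%:R * t) ^+ d.
  by rewrite hornerZ horner_exp hornerD hornerN hornerC hornerZ hornerX.
have := @le_poly_at0 R p q d; rewrite pE qE mulr0 subr0 expr1n mulr1.
under eq_bigr do under eq_bigr do rewrite addr0.
apply=> n dn; rewrite pE qE.
have n0 : (0 < n)%N by lia.
have nR : 0 < n%:R :> R by rewrite ltr0n.
have nR0 : n%:R != 0 :> R by rewrite gt_eqF.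
rewrite -(ler_pM2r (exprn_gt0 d nR)) -mulrA -exprMn mulrBl mul1r divfK//.
rewrite -natrB ?(ltnW dn)//; apply: le_trans (low n dn) _.
rewrite /L -lattice_count_cone// -[lattice_count _ _]/(ncard _).
pose Y k := lattice `&` box (n%:R *: a k) (n%:R *: b k).
have YP k : finite_set (Y k) /\ (ncard (Y k))%:R <= \prod_j (n%:R * (b k 0 j - a k 0 j) + 1) :> R.
  have [|fY cY] := @lattice_box_count R d (n%:R *: a k) (n%:R *: b k).
    by move=> j; rewrite !mxE ler_pM2l.
  split=> //; apply: le_trans cY _.
  by rewrite le_eqVlt; apply/orP; left; apply/eqP; apply: eq_bigr => j _; rewrite !mxE mulrBr.
have : (ncard (dilate n (polytope V) `&` lattice) <= \sum_k ncard (Y k))%N.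
  apply: ncard_cover; [exact: finite_dilate|by move=> k; have [] := YP k|].
  move=> _ [[x /cov[k xb] <-] xl]; exists k; split=> // j; rewrite !mxE.
  by have /andP[? ?] := xb j; rewrite !ler_pM2l//; apply/andP.
rewrite -(ler_nat R) natr_sum => h; apply: le_trans h _.
rewrite mulr_suml; apply: ler_sum => k _; have [_ h] := YP k; apply: le_trans h _.
rewrite -[X in _ ^+ X](card_ord d) -prodr_const -big_split/=.
rewrite le_eqVlt; apply/orP; left; apply/eqP; apply: eq_bigr => j _.
by rewrite mulrDl mulVf// mulrC.
Qed.

(** Countable covers reduce to finite ones by compactness, after enlarging the [k]-th box at the
    cost of [e / 2 ^+ k.+1] so that interiors still cover. *)
Lemma le_outer_measure :
  (forall n, (d < n)%N -> v0 * (n - d)%:R ^+ d <= (L n)%:R) ->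
  (v0%:E <= lebesgue_outer (polytope V))%E.
Proof.
move=> low; apply: le_ereal_inf_tmp => _ [a [b [ab cov ->]]].
apply/lee_addgt0Pr => e e0.
have /choice[t tP] k : exists t : R, 0 < t /\
    box_volume (a k - const_mx t) (b k + const_mx t) <=
    box_volume (a k) (b k) + e / 2 ^+ k.+1.
  have [|t] := @box_enlarge (a k) (b k) (e / 2 ^+ k.+1) (ab k).
    by rewrite divr_gt0// exprn_gt0.
  by exists t.
pose a' k := a k - const_mx (t k); pose b' k := b k + const_mx (t k).
have := @polytope_compact R N d V; rewrite compact_cover.
move=> /(_ nat setT (fun k => (box (a' k) (b' k))°)) [].
- by move=> k _; exact: open_interior.
- move=> x /cov[k _ xk]; exists k => //; apply: box_interior => //.
  by have [] := tP k.
(* All boxes of index below [M] are kept; those outside the subcover only increase the sum. *)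
move=> D _ DP; pose M := (\max_(k <- D) k).+1.
have := @finite_cover_volume M (fun k => a' k) (fun k => b' k) low.
move=> /(_ _ _)/wrap[k j|x /DP[k kD xk]|].
- rewrite !mxE; have [t0 _] := tP k; have := ab k j; lra.
- have kM : (k < M)%N by rewrite ltnS; exact: leq_bigmax_seq.
  by exists (Ordinal kM); exact: interior_subset.
move=> h; apply: (@le_trans _ _ ((\sum_(k < M) box_volume (a k) (b k) + e)%:E)).
  rewrite lee_fin; apply: le_trans h _.
  apply: (@le_trans _ _ (\sum_(k < M) (box_volume (a k) (b k) + e / 2 ^+ k.+1))).
    by apply: ler_sum => k _; have [] := tP k.
  rewrite big_split/= lerD2l.
  have -> : \sum_(k < M) e / 2 ^+ k.+1 = e - e / 2 ^+ M.
    elim: M => [|m IH]; first by rewrite big_ord0 expr0 divr1 subrr.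
    by rewrite big_ord_recr/= IH exprS; field; rewrite expf_neq0.
  by rewrite gerBl divr_ge0 ?exprn_ge0// ltW.
rewrite EFinD leeD2r// -sumEFin -(big_mkord xpredT (fun k => (box_volume (a k) (b k))%:E)).
by apply: nneseries_lim_ge => k _ _; rewrite lee_fin box_volume_ge0.
Qed.

End OuterMeasure.

(** * Upper bound for the outer measure *)

Section OuterMeasureUpper.
Variables (R : realType).

(** A large multiple of the sum of the generators lies so deep in the cone that the unit cube around
    it stays inside. This absorbs the error of rounding to a lattice point. *)
Lemma cone_absorbs_cube N D (A : 'M[R]_(N, D)) :
  (forall v, exists l : 'rV_N, l *m A = v) ->
  exists c : nat, forall u : 'rV[R]_D, (forall j, `|u 0 j| <= 1) ->
    exists2 l : 'rV_N, nonneg_vec l & l *m A = c%:R *: (const_mx 1 *m A) + u.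
Proof.
move=> Aspan; have /choice[L LP] j : exists l : 'rV_N, l *m A = delta_mx 0 j.
  exact: Aspan.
pose K := \sum_i \sum_j `|L j 0 i|; pose c := Num.bound K.
have Kc : K <= c%:R.
  by apply/ltW/archi_boundP; apply: sumr_ge0 => i _; exact: sumr_ge0.
exists c => u u1; exists (c%:R *: const_mx 1 + \sum_j u 0 j *: L j); last first.
  rewrite mulmxDl -scalemxAl; congr (_ + _); rewrite mulmx_suml [RHS]row_sum_delta.
  by apply: eq_bigr => j _; rewrite -scalemxAl LP.
move=> i; rewrite !mxE mulr1 -lerBlDl sub0r summxE.
apply: (@le_trans _ _ (- K)); first by rewrite lerN2.
rewrite lerNl -sumrN; apply: (@le_trans _ _ (\sum_j `|L j 0 i|)).
  apply: ler_sum => j _; rewrite mxE -mulNr (le_trans (ler_norm _))// normrM normrN.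
  by rewrite ler_piMl.
rewrite /K (bigD1 i)//= lerDl; apply: sumr_ge0 => k _; exact: sumr_ge0.
Qed.

Lemma outer_measure_le N d (V : 'M[R]_(N, d)) : (0 < d)%N ->
  (forall i, lattice (row i V)) ->
  (forall v, exists l : 'rV_N, l *m cone_mx V = v) ->
  exists c : nat, forall n, (0 < n)%N ->
    (lebesgue_outer (polytope V) <=
     ((ncard (cone_slice (cone_mx V) (n + c)))%:R / n%:R ^+ d)%:E)%E.
Proof.
move=> d0 Vl Aspan; set A := cone_mx V in Aspan *.
have A0 i : A i 0 = 1 by exact: cone_mx0.
have Al : forall i, lattice (row i A) by exact: cone_mx_lattice.
have [c' cP] := cone_absorbs_cube Aspan.
(* The shift is [c'] times the sum of the [N] generators, which has height [N]. *)
exists (c' * N)%N => n n0; have nR : 0 < n%:R :> R by rewrite ltr0n.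
set c := (c' * N)%N; set C := cone_slice A (n + c).
have fC : finite_set C by exact: finite_cone_slice.
pose zs : seq 'rV[R]_d.+1 := fset_set C.
pose g := base_part (c'%:R *: (const_mx 1 *m A)).
have gl : lattice g.
  move=> j; rewrite !mxE rpredM ?natr_int// rpred_sum// => i _.
  by rewrite mxE mul1r; have := Al i (lift ord0 j); rewrite mxE.
(* One cube of side 1/n per lattice point at height [n + c], moved back by [g]. The remaining boxes
   are single points, of volume 0 because [0 < d]. *)
pose a k := if (k < size zs)%N then n%:R^-1 *: (base_part (nth 0 zs k) - g) else 0.
pose b k := if (k < size zs)%N then a k + const_mx n%:R^-1 else 0.
apply: ereal_inf_lbound; exists a, b; split.
- move=> k j; rewrite /b; case: ifP => [_|kz]; last by rewrite /a kz.
  by rewrite !mxE lerDl invr_ge0 ltW.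
(* Rounding [n%:R *: x] down to [z] may leave the cone, but [z + g] at height [n + c] is in it, and
   its cube contains [x]. *)
- move=> x /polytope_cone[l l0 lx]; pose z : 'rV[R]_d := \row_j (Num.floor (n%:R * x 0 j))%:~R.
  have zx j : z 0 j <= n%:R * x 0 j <= z 0 j + 1.
    have := floor_itv (n%:R * x 0 j); rewrite intrD mxE => /andP[-> ?].
    exact/ltW.
  have [j|l' l'0 l'A] := cP (at_height 0 (z - n%:R *: x)).
    case: (unliftP ord0 j) => [k ->|->]; last by rewrite at_height0 normr0.
    by rewrite at_heightS !mxE ler_norml; have := zx k; rewrite mxE; lra.
  pose X := at_height (n + c)%:R (z + g).
  have XE : (n%:R *: l + l') *m A = X.
    rewrite mulmxDl -scalemxAl lx l'A; apply: eq_at_height.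
      rewrite !mxE !unlift_none addr0 natrD mulr1 natrM; congr (_ + _ * _).
      under eq_bigr do rewrite mxE A0 mulr1.
      by rewrite sumr_const card_ord.
    move=> j; rewrite /g; set w := const_mx 1 *m A.
    by rewrite !mxE liftK !mxE; lra.
  have XC : C X.
    split; [|exact: at_height0|].
      apply/lattice_at_height/latticeD => // j; by rewrite mxE intr_int.
    exists (n%:R *: l + l') => // i; rewrite !mxE addr_ge0// mulr_ge0//; exact/ltW.
  have Xz : X \in zs by rewrite in_fset_set// inE.
  exists (index X zs) => // j.
  rewrite /b /a index_mem Xz nth_index// /X at_heightK addrK !mxE.
  have := zx j; rewrite mxE; set zj := _%:~R; move: zj (x 0 j) => zj xj /andP[z1 z2].
  apply/andP; split; first by rewrite ler_pdivrMl.
  by rewrite -[X in _ + X]mulr1 -mulrDr ler_pdivlMl.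
- rewrite (@box_cover_sum R (size zs)).
  + congr EFin; rewrite -[ncard _]/(size zs) -[X in X%:R](card_ord (size zs)).
    rewrite -sumr_const mulr_suml; apply: eq_bigr => k _.
    rewrite mul1r -exprVn -[X in _ ^+ X](card_ord d) -prodr_const.
    by apply: eq_bigr => j _; rewrite /b (ltn_ord k) !mxE addrAC subrr add0r.
  + move=> k; apply: box_volume_ge0 => j; rewrite /b; case: ifP => [_|kz]; last by rewrite /a kz.
    by rewrite !mxE lerDl invr_ge0 ltW.
  + move=> k; rewrite leqNgt => /negbTE kz; rewrite /box_volume (bigD1 (Ordinal d0))//=.
    by rewrite /a /b kz subrr mul0r.
Qed.

Theorem outer_measure_polytope N d (V : 'M[R]_(N, d)) (h : nat -> nat) : (0 < d)%N ->
  (forall i, lattice (row i V)) ->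
  (forall v, exists l : 'rV_N, l *m cone_mx V = v) ->
  (forall n, ncard (cone_slice (cone_mx V) n) =
     (\sum_(k < d.+1) h k * 'C(n + d - k, d))%N) ->
  lebesgue_outer (polytope V) = ((\sum_(k < d.+1) h k)%:R / d`!%:R)%:E.
Proof.
move=> d0 Vl Aspan count; set v0 : R := _ / _.
have f0 : 0 < d`!%:R :> R by rewrite ltr0n fact_gt0.
have fcount n : (ncard (cone_slice (cone_mx V) n))%:R * d`!%:R =
    (\sum_(k < d.+1) h k * (n + d - k) ^_ d)%N%:R :> R.
  rewrite -natrM count big_distrl/=; congr _%:R; apply: eq_bigr => k _.
  by rewrite -mulnA bin_ffact.
have low : (v0%:E <= lebesgue_outer (polytope V))%E.
  apply: le_outer_measure => n dn; rewrite -(ler_pM2r f0) fcount mulrAC divfK ?gt_eqF//.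
  rewrite -natrX -natrM ler_nat big_distrl/=; apply: leq_sum => k _.
  by rewrite leq_mul2l expn_leq_ffact ?orbT// -ltnS.
have [c up] := outer_measure_le d0 Vl Aspan.
(* The upper bound at [n = 1] already gives finiteness. *)
have : lebesgue_outer (polytope V) \is a fin_num.
  rewrite fin_numElt (lt_le_trans (ltNyr _) low).
  by rewrite (le_lt_trans (up 1%N isT))// ltry.
move: low up; case: (lebesgue_outer _) => // r; rewrite lee_fin => low up _.
congr EFin; apply/eqP; rewrite eq_le low andbT.
pose q : {poly R} := v0 *: (1 + (c + d)%:R *: 'X) ^+ d.
have qE t : q.[t] = v0 * (1 + (c + d)%:R * t) ^+ d.
  by rewrite hornerZ horner_exp hornerD hornerC hornerZ hornerX.
have := @le_poly_at0 R r%:P q 0; rewrite hornerC qE mulr0 addr0 expr1n mulr1.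
apply=> n n0; rewrite hornerC qE; have nR : 0 < n%:R :> R by rewrite ltr0n.
have := up n n0; rewrite lee_fin => h'; apply: le_trans h' _.
rewrite ler_pdivrMr ?exprn_gt0// -mulrA -exprMn mulrDl mul1r divfK ?gt_eqF//.
rewrite -(ler_pM2r f0) fcount mulrAC divfK ?gt_eqF// -natrD -natrX -natrM ler_nat.
rewrite big_distrl/=; apply: leq_sum => k _; rewrite leq_mul2l.
by rewrite (leq_trans (ffact_leq_expn _ _)) ?orbT// leq_exp2r//; lia.
Qed.

End OuterMeasureUpper.

(** * Coefficients of shifted factorials *)

Section ShiftedFactorials.
Implicit Types (a b p r : nat).

(* [c_poly d j] with [d = a + b + 1] and [j = a], divided by its root [X]. *)
Definition two_sided a b : {poly int} :=
  \prod_(k < a) ('X + (k.+1%:Z)%:P) * \prod_(k < b) ('X - (k.+1%:Z)%:P).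

Definition ts_coef r a b : int := (two_sided a b)`_r.

Lemma two_sidedSl a b : two_sided a.+1 b = two_sided a b * ('X + (a.+1%:Z)%:P).
Proof. by rewrite /two_sided big_ord_recr/= mulrAC. Qed.

Lemma two_sidedSr a b : two_sided a b.+1 = two_sided a b * ('X - (b.+1%:Z)%:P).
Proof. by rewrite /two_sided [in LHS]big_ord_recr/= mulrA. Qed.

Lemma coefMXaddC_S (P : {poly int}) c r :
  (P * ('X + c%:P))`_r.+1 = P`_r + c * P`_r.+1.
Proof. by rewrite mulrDr coefD coefMX coefMC mulrC. Qed.

Lemma coefMXaddC_0 (P : {poly int}) c : (P * ('X + c%:P))`_0 = c * P`_0.
Proof. by rewrite mulrDr coefD coefMX coefMC add0r mulrC. Qed.

Lemma ts_coef0l a b : ts_coef 0 a.+1 b = a.+1%:Z * ts_coef 0 a b.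
Proof. by rewrite /ts_coef two_sidedSl coefMXaddC_0. Qed.
Lemma ts_coef0r a b : ts_coef 0 a b.+1 = - b.+1%:Z * ts_coef 0 a b.
Proof. by rewrite /ts_coef two_sidedSr -polyCN coefMXaddC_0. Qed.
Lemma ts_coefSl r a b :
  ts_coef r.+1 a.+1 b = ts_coef r a b + a.+1%:Z * ts_coef r.+1 a b.
Proof. by rewrite /ts_coef two_sidedSl coefMXaddC_S. Qed.
Lemma ts_coefSr r a b :
  ts_coef r.+1 a b.+1 = ts_coef r a b - b.+1%:Z * ts_coef r.+1 a b.
Proof. by rewrite /ts_coef two_sidedSr -polyCN coefMXaddC_S mulNr. Qed.
Lemma ts_coef00 r : ts_coef r 0 0 = (r == 0%N)%:R.
Proof. by rewrite /ts_coef /two_sided !big_ord0 mulr1 coef1. Qed.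

Lemma normr_posz (n : nat) : `|n%:Z| = n%:Z.
Proof. by []. Qed.

Lemma ts_coef_end m r : `|ts_coef r 0 m| <= ts_coef r m 0.
Proof.
elim: m r => [|m IH] r; first by rewrite !ts_coef00; case: eqP.
case: r => [|r].
  by rewrite ts_coef0l ts_coef0r normrM normrN normr_posz ler_wpM2l.
rewrite ts_coefSl ts_coefSr (le_trans (ler_normB _ _))// lerD//.
by rewrite normrM normr_posz ler_wpM2l.
Qed.

(** Absolute values are needed for the induction, since removing a factor ['X - c] flips the sign of
    one term of the recurrence. Both [a] and [b] are positive because the one-sided products have
    larger coefficients. *)
Definition dominated r p := forall a b, (0 < a)%N -> (0 < b)%N ->
  (a + b = p.+1)%N -> `|ts_coef r a b| <= - ts_coef r p 1.

(** The constant coefficient is a! b! up to sign, largest for the most unequal split. *)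
Lemma dominated0 p : (0 < p)%N -> dominated 0 p.
Proof.
case: p => // p _; elim: p => [|p IH] a b a0 b0 ab.
  have [-> ->] : a = 1%N /\ b = 1%N by lia.
  by rewrite !(ts_coef0l, ts_coef0r) ts_coef00.
have nn : 0 <= - ts_coef 0 p.+1 1 by exact: le_trans (IH 1%N p.+1 isT isT erefl).
rewrite ts_coef0l -mulrN.
have [a1|a1] := ltnP 1 a.
  case: a a0 a1 ab => // a _ a1 ab; rewrite ts_coef0l normrM normr_posz.
  apply: le_trans (_ : a.+1%:Z * - ts_coef 0 p.+1 1 <= _).
    by rewrite ler_wpM2l// IH//; lia.
  by rewrite ler_wpM2r// lez_nat; lia.
case: b b0 ab => // b _ ab; rewrite ts_coef0r normrM normrN normr_posz.
apply: le_trans (_ : b.+1%:Z * - ts_coef 0 p.+1 1 <= _).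
  by rewrite ler_wpM2l// IH//; lia.
by rewrite ler_wpM2r// lez_nat; lia.
Qed.

Lemma dominatedS r p : (0 < p)%N -> dominated r p -> dominated r.+1 p ->
  dominated r.+1 p.+1.
Proof.
move=> p0 D1 D2 a b a0 b0 ab.
have nn : 0 <= - ts_coef r.+1 p 1 by apply: le_trans (D2 p 1%N p0 isT (addn1 p)).
rewrite ts_coefSl opprD -mulrN.
(* A factor is removed from a side that has at least two, so that both sides stay nonempty; its
   constant is at most [p + 1] in absolute value, the one in the recurrence for the right-hand
   side. *)
have [a1|a1] := ltnP 1 a.
  case: a a0 a1 ab => // a _ a1 ab; rewrite ts_coefSl (le_trans (ler_normD _ _))//.
  apply: lerD; first by apply: D1; lia.
  rewrite normrM normr_posz.
  apply: le_trans (_ : a.+1%:Z * - ts_coef r.+1 p 1 <= _).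
    by rewrite ler_wpM2l// D2//; lia.
  by rewrite ler_wpM2r// lez_nat; lia.
case: b b0 ab => // b _ ab; rewrite ts_coefSr (le_trans (ler_normB _ _))//.
apply: lerD; first by apply: D1; lia.
  rewrite normrM normr_posz.
apply: le_trans (_ : b.+1%:Z * - ts_coef r.+1 p 1 <= _).
  by rewrite ler_wpM2l// D2//; lia.
by rewrite ler_wpM2r// lez_nat; lia.
Qed.

Lemma dominated1 p : (0 < p)%N -> dominated 1 p.
Proof.
case: p => // p _; elim: p => [|p IH]; last by apply: dominatedS => //; exact: dominated0.
move=> a b a0 b0 ab; have [-> ->] : a = 1%N /\ b = 1%N by lia.
by rewrite !(ts_coefSl, ts_coefSr, ts_coef0l, ts_coef0r, ts_coef00).
Qed.

(** Multiplication by ['X + c] on the three lowest coefficients, with plain integers so that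
    [vm_compute] evaluates it. *)
Definition ts_step (c : int) (t : int * int * int) : int * int * int :=
  let: (x, y, z) := t in (c * x, x + c * y, y + c * z).
Definition ts_table a b : int * int * int :=
  iteri b (fun k => ts_step (- k.+1%:Z)) (iteri a (fun k => ts_step k.+1%:Z) (1, 0, 0)).

Lemma ts_tableE a b :
  ts_table a b = (ts_coef 0 a b, ts_coef 1 a b, ts_coef 2 a b).
Proof.
elim: b => [|b IH].
  elim: a => [|a IH]; first by rewrite !ts_coef00.
  by move: IH; rewrite /ts_table/= => ->; rewrite /ts_step ts_coef0l !ts_coefSl.
move: IH; rewrite /ts_table/= => ->.
by rewrite /ts_step ts_coef0r !ts_coefSr !mulNr.
Qed.

Lemma ts_coef2E a b : ts_coef 2 a b = (ts_table a b).2.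
Proof. by rewrite ts_tableE. Qed.

(** The value [p = 8] is the first at which the split (p, 1) has the largest absolute value; it is
    checked by computation and starts the induction. *)
Lemma dominated2 p : (8 <= p)%N -> dominated 2 p.
Proof.
move=> /subnKC <-; elim: (p - _)%N => [|q IH].
  rewrite addn0; move=> a b a0 b0 ab; have -> : b = (9 - a)%N by lia.
  have /allP h : all (fun a => `|(ts_table a (9 - a)).2| <= - (ts_table 8 1).2) (iota 1 8).
    by vm_compute.
  by rewrite !ts_coef2E; apply: h; rewrite mem_iota; lia.
rewrite addnS; apply: dominatedS => //; exact: dominated1.
Qed.

(** Substituting [- 'X] exchanges the two one-sided products up to a global sign. *)
Lemma ts_coef_sign r m : ts_coef r m 0 = (-1) ^+ (m + r) * ts_coef r 0 m.
Proof.
elim: m r => [|m IH] [|r]; rewrite ?ts_coef00 ?mulr0//.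
  by rewrite ts_coef0l ts_coef0r IH !addn0 exprS; ring.
by rewrite ts_coefSl ts_coefSr !IH !addnS addSn !exprS; ring.
Qed.

Lemma c_poly_diag d : c_poly d d%:Z = two_sided d 0.
Proof.
rewrite /c_poly /two_sided big_ord0 mulr1 (reindex_inj rev_ord_inj)/=.
apply: eq_bigr => k _; congr ('X + _%:P); have := ltn_ord k; lia.
Qed.

Lemma c_polyE a b : c_poly (a + b).+1 a%:Z = 'X * two_sided a b.
Proof.
rewrite /c_poly /two_sided -(big_mkord xpredT (fun k => 'X + (a%:Z - k%:Z)%:P)).
rewrite (big_cat_nat (n := a))/=; [|lia..].
rewrite [X in _ * X]big_ltn; last lia.
rewrite subrr addr0 mulrCA; congr (_ * (_ * _)).
  rewrite big_nat_rev/= big_mkord; apply: eq_bigr => k _; congr ('X + _%:P).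
  have := ltn_ord k; lia.
rewrite -[a.+1]add0n big_addn (_ : ((a + b).+1 - a.+1 = b)%N); last lia.
rewrite big_mkord; apply: eq_bigr => k _; rewrite -polyCN; congr ('X + _%:P); lia.
Qed.

Lemma c_coef3E a b : c_coef (a + b).+1 3 a%:Z = ts_coef 2 a b.
Proof. by rewrite /c_coef c_polyE mulrC coefMX. Qed.

(** Identifies the Stirling term of the bound as the contribution of [h 0 = 1]. *)
Lemma stirl_c_coef d : (0 < d)%N -> (-1) ^+ (d - 1) * stirl d.+1 4 = c_coef d 3 d%:Z.
Proof.
case: d => // d _; rewrite /c_coef c_poly_diag -/(ts_coef 3 d.+1 0) ts_coef_sign.
rewrite subn1/= /stirl big_ord_recl/= subr0 coefXM/=.
have -> : \prod_(k < d.+1) ('X - ((bump 0 k)%:Z)%:P) = two_sided 0 d.+1 :> {poly int}.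
  by rewrite /two_sided big_ord0 mul1r; apply: eq_bigr => k _; rewrite /bump add1n.
by rewrite -/(ts_coef 3 0 d.+1) mulrC (_ : (d.+1 + 3 = d + 4)%N) ?exprD; [ring|lia].
Qed.

(** The h-vector index with the least coefficient among 2, ..., d - 1. The shifts 3 and 2 are the
    splits (d - 3, 2) and (d - 2, 1). *)
Definition extremal_shift d : nat := if (d <= 9)%N then 3 else 2.

Lemma c_coef3_extremal d : (6 <= d)%N ->
  let M := c_coef d 3 (d%:Z - (extremal_shift d)%:Z) in
  M <= 0 /\ forall k, (1 < k)%N -> (k < d)%N -> M <= c_coef d 3 (d%:Z - k%:Z).
Proof.
move=> d6 /=; have E k : (0 < k)%N -> (k <= d)%N ->
    c_coef d 3 (d%:Z - k%:Z) = ts_coef 2 (d - k) k.-1.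
  move=> k0 kd; rewrite -c_coef3E (_ : ((d - k + k.-1).+1 = d)%N); last lia.
  by congr c_coef; lia.
rewrite /extremal_shift; case: leqP => d9.
  have /allP h : all (fun d => ((ts_table (d - 3) 2).2 <= 0) &&
      all (fun k => (ts_table (d - 3) 2).2 <= (ts_table (d - k) k.-1).2) (iota 2 (d - 2)))
      (iota 6 4).
    by vm_compute.
  have /h /andP[h1 /allP h2] : d \in iota 6 4 by rewrite mem_iota; lia.
  rewrite E//; last lia.
  split=> [|k k1 kd]; first by rewrite ts_coef2E.
  by rewrite E ?ts_coef2E; [|lia..]; apply: h2; rewrite mem_iota; lia.
have D : dominated 2 (d - 2) by apply: dominated2; lia.
rewrite E//; last lia.
split=> [|k k1 kd].
  rewrite -oppr_ge0; apply: le_trans (normr_ge0 _) (D (d - 2)%N 1%N _ _ _); lia.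
rewrite E; [|lia..].
rewrite -[X in X <= _]opprK lerNl (le_trans (ler_norm _))// normrN D//; lia.
Qed.

Lemma c_coef3_ends d : (0 < d)%N ->
  `|c_coef d 3 (d%:Z - d%:Z)| <= c_coef d 3 (d%:Z - 1%:Z).
Proof.
case: d => // d _; rewrite subrr -[X in c_coef X _ 0](add0n d.+1) addnS (c_coef3E 0 d).
rewrite (_ : d.+1%:Z - 1%:Z = d%:Z); last lia.
by rewrite -{2}(addn0 d) c_coef3E ts_coef_end.
Qed.

Theorem h_vector_bound d (h : nat -> nat) : (6 <= d)%N -> h 0%N = 1%N ->
  (h d <= h 1)%N ->
  c_coef d 3 d%:Z + ((\sum_(k < d.+1) h k)%N%:Z - 1) *
    c_coef d 3 (d%:Z - (extremal_shift d)%:Z) <=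
  \sum_(k < d.+1) (h k)%:Z * c_coef d 3 (d%:Z - k%:Z).
Proof.
move=> d6 h0 hd1; have [M0 MC] := c_coef3_extremal d6; set M := c_coef d 3 _ in M0 MC *.
case: d d6 hd1 @M M0 MC => // -[|d] // d6 hd1 M M0 MC.
have := @c_coef3_ends d.+2 isT; move=> Pe.
pose C k := c_coef d.+2 3 (d.+2%:Z - k%:Z).
rewrite (eq_bigr (fun k : 'I_d.+3 => (h k)%:Z * C k))//.
rewrite (big_morph Posz PoszD (erefl _)).
rewrite 2!big_ord_recl [X in _ <= X]big_ord_recl [X in _ <= _ + X]big_ord_recl/=.
rewrite big_ord_recr [X in _ <= _ + (_ + X)]big_ord_recr/= /bump/= !add1n h0.
have -> : c_coef d.+2 3 d.+2%:Z = C 0%N by rewrite /C subr0.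
have mid : (\sum_(i < d) (h i.+2)%:Z) * M <= \sum_(i < d) (h i.+2)%:Z * C i.+2.
  rewrite mulr_suml; apply: ler_sum => i _; rewrite ler_wpM2l//.
  by apply: MC; have := ltn_ord i; lia.
(* Since [C 1] is nonnegative and [h d.+2 <= h 1], the right side is at least [h d.+2] times
   [C 1 + C d.+2], hence nonnegative, while the left side is nonpositive. *)
have ends : (h 1)%:Z * M + (h d.+2)%:Z * M <= (h 1)%:Z * C 1%N + (h d.+2)%:Z * C d.+2.
  have C1 : - C 1%N <= C d.+2 by have := ler_norm (- C d.+2); rewrite normrN /C; lia.
  have C0 : 0 <= C 1%N by rewrite /C (le_trans (normr_ge0 _) Pe).
  have e1 : (h d.+2)%:Z * C 1%N <= (h 1%N)%:Z * C 1%N by rewrite ler_wpM2r.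
  have e2 : 0 <= (h d.+2)%:Z * (C 1%N + C d.+2) by rewrite mulr_ge0//; lia.
  have e3 : ((h 1%N)%:Z + (h d.+2)%:Z) * M <= 0 by rewrite mulr_ge0_le0.
  by move: e1 e2 e3; clearbody C M; lra.
move: mid ends; set sh := \sum_(i < d) _; set sc := \sum_(i < d) _ => mid ends.
rewrite -[leLHS]/(C 0%N + (1 + ((h 1%N)%:Z + (sh + (h d.+2)%:Z)) - 1) * M).
rewrite -[leRHS]/(1 * C 0%N + ((h 1%N)%:Z * C 1%N + (sc + (h d.+2)%:Z * C d.+2))).
by clearbody C M sh sc; lra.
Qed.

End ShiftedFactorials.

(** * The lower bound *)

Section EhrhartCoefficients.
Variables (R : realType) (d : nat) (P : set 'rV[R]_d) (h : nat -> nat).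
Hypothesis Ph : forall n, (0 < n)%N ->
  lattice_count P n = (\sum_(k < d.+1) h k * 'C(n + d - k, d))%N.

Lemma c_poly_bin n k : (k <= d)%N ->
  (c_poly d (d%:Z - k%:Z)).[n%:Z] = (d`! * 'C(n + d - k, d))%N%:Z.
Proof.
move=> kd; rewrite mulnC bin_ffact /c_poly horner_prod.
have [dn|nd] := leqP d (n + d - k).
  rewrite ffact_prod (big_morph Posz PoszM (erefl _)); apply: eq_bigr => l _.
  by rewrite hornerD hornerX hornerC; have := ltn_ord l; lia.
(* For [n < k] the factor of index [n + d - k] is zero. *)
rewrite ffact_small//; have ld : (n + d - k < d)%N by [].
rewrite (bigD1 (Ordinal ld))//= hornerD hornerX hornerC [X in X * _](_ : _ = 0) ?mul0r//.
lia.
Qed.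

Lemma ehrhart_coefE r : ehrhart_coef r P =
  d`!%:R^-1 * (\sum_(k < d.+1) (h k)%:Z * c_coef d r (d%:Z - k%:Z))%:~R.
Proof.
have f0 : d`!%:R != 0 :> R by rewrite pnatr_eq0 -lt0n fact_gt0.
pose p : {poly R} := d`!%:R^-1 *:
  map_poly intr (\sum_(k < d.+1) (h k)%:Z *: c_poly d (d%:Z - k%:Z)).
have pP : is_ehrhart_poly P p.
  move=> n n0; rewrite Ph// hornerZ -[n%:R]/((n%:Z)%:~R : R) horner_map/=.
  rewrite horner_sum; apply: (mulfI f0); rewrite mulrA divff// mul1r -natrM.
  rewrite -[RHS]/((_%:Z)%:~R : R); congr (_%:~R).
  rewrite big_distrr/= (big_morph Posz PoszD (erefl _)); apply: eq_bigr => k _.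
  rewrite hornerZ c_poly_bin; last by rewrite -ltnS.
  by rewrite -PoszM mulnCA.
have -> : ehrhart_coef r P = p`_r.
  rewrite /ehrhart_coef; suff -> : ehrhart_poly P = p by [].
  rewrite /ehrhart_poly; have : is_ehrhart_poly P (xget 0 [set p | is_ehrhart_poly P p]).
    by apply: (@xgetPex _ 0 [set p | is_ehrhart_poly P p]); exists p.
  set q := xget _ _ => qP; apply/eqP; rewrite -subr_eq0; apply/eqP.
  apply: contrapT => /eqP qp0.
  pose s := [seq (k.+1)%:R : R | k <- iota 0 (size (q - p))].
  have us : uniq s.
    by rewrite map_inj_uniq ?iota_uniq// => a b /eqP; rewrite eqr_nat eqSS => /eqP.
  have rs : all (root (q - p)) s.
    apply/allP => _ /mapP[k _ ->]; rewrite rootE hornerD hornerN subr_eq0.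
    by rewrite qP// pP.
  by have := max_poly_roots qp0 rs us; rewrite size_map size_iota ltnn.
rewrite coefZ coef_map/= coef_sum; congr (_ * _%:~R).
by apply: eq_bigr => k _; rewrite coefZ.
Qed.

Lemma g3_boundE (v : R) : (0 < d)%N -> v = (\sum_(k < d.+1) h k)%:R / d`!%:R ->
  g3_bound d v = d`!%:R^-1 * (c_coef d 3 d%:Z +
    ((\sum_(k < d.+1) h k)%N%:Z - 1) *
     c_coef d 3 (d%:Z - (extremal_shift d)%:Z))%:~R.
Proof.
move=> d0 ->; have f0 : d`!%:R != 0 :> R by rewrite pnatr_eq0 -lt0n fact_gt0.
rewrite /g3_bound /extremal_shift [_ * (_ / _)]mulrC divfK// -stirl_c_coef//.
by case: ifP => _; rewrite !(intrD, intrM, rmorphXn)/= ?rmorphN.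
Qed.

End EhrhartCoefficients.

(** * Irredundant vertex representations *)

Section VertexRepresentation.
Variables (R : realType) (d : nat).
Implicit Types (P : set 'rV[R]_d).

Lemma convex_polytope_rows P : convex_polytope P ->
  exists N (V : 'M[R]_(N, d)), P = polytope V.
Proof.
move=> [A [/finite_seqP[s ->] ->]]; exists (size s), (\matrix_i nth 0 s i).
rewrite /polytope; congr conv_hull; apply/seteqP; split=> x /=.
  move=> xs; have ix : (index x s < size s)%N by rewrite index_mem.
  by exists (Ordinal ix) => //; rewrite rowK nth_index.
by move=> [i _ <-]; rewrite rowK mem_nth.
Qed.

Lemma polytope_row'P N (V : 'M[R]_(N.+1, d)) i x : polytope (row' i V) x <->
  exists m : 'rV_N.+1, [/\ nonneg_vec m, \sum_j m 0 j = 1, m 0 i = 0 & x = m *m V].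
Proof.
have E (m : 'rV[R]_N.+1) : m 0 i = 0 ->
    m *m V = (\row_j m 0 (lift i j)) *m row' i V.
  move=> mi; apply/rowP => k; rewrite !mxE (bigD1_ord i)//= mi mul0r add0r.
  by apply: eq_bigr => j _; rewrite !mxE.
have S (m : 'rV[R]_N.+1) : m 0 i = 0 ->
    \sum_j m 0 j = \sum_j (\row_j m 0 (lift i j)) 0 j :> R.
  by move=> mi; rewrite (bigD1_ord i)//= mi add0r; apply: eq_bigr => j _; rewrite mxE.
rewrite polytopeP; split=> [[l [l0 l1 ->]]|[m [m0 m1 mi ->]]].
  pose m : 'rV[R]_N.+1 := \row_j (if unlift i j is Some k then l 0 k else 0).
  have mi : m 0 i = 0 by rewrite mxE unlift_none.
  have ml : \row_j m 0 (lift i j) = l by apply/rowP => j; rewrite !mxE liftK.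
  exists m; split=> //; [|by rewrite S// ml|by rewrite E// ml].
  by move=> j; rewrite mxE; case: unlift.
exists (\row_j m 0 (lift i j)); split; [by move=> j; rewrite mxE|by rewrite -S|exact: E].
Qed.

Lemma minimal_irredundant N (V : 'M[R]_(N.+1, d)) :
  (forall i, polytope (row' i V) <> polytope V) -> irredundant (cone_mx V).
Proof.
move=> Vmin i l l0 lA; have [l1 lV] : \sum_j l 0 j = 1 /\ l *m V = row i V.
  move: lA; rewrite mul_cone_mx row_cone_mx => lA; split.
    by have := congr1 (fun v : 'rV_d.+1 => v 0 0) lA; rewrite !at_height0.
  by have := congr1 (@base_part R d) lA; rewrite !at_heightK.
apply: contrapT => /eqP li1; have li : l 0 i < 1.
  rewrite lt_neqAle li1/= -l1 (bigD1 i)//= lerDl sumr_ge0// => j _; exact: l0.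
have cp : 0 < 1 - l 0 i by rewrite subr_gt0.
apply: (Vmin i); apply/seteqP; split=> x.
  by move=> /polytope_row'P[m [m0 m1 _ ->]]; apply/polytopeP; exists m.
move=> /polytopeP[m [m0 m1 ->]]; apply/polytope_row'P.
pose c := (1 - l 0 i)^-1; have c0 : 0 <= c by rewrite invr_ge0 ltW.
(* The weight of [m] on row [i] moves to the other rows, along the expression of row [i] through
   them with factor [1 / (1 - l 0 i)]. *)
exists (m + m 0 i *: (c *: (l - l 0 i *: delta_mx 0 i) - delta_mx 0 i)); split.
- move=> j; rewrite !mxE eqxx/=; have [->|ji] := eqVneq j i.
    by rewrite mulr1 subrr mulr0 sub0r mulrN1 subrr.
  by rewrite mulr0 !subr0 addr_ge0// !mulr_ge0.
- have sd : \sum_j (delta_mx 0 i : 'rV[R]_N.+1) 0 j = 1.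
    rewrite (bigD1 i)//= mxE !eqxx big1 ?addr0// => j ji.
    by rewrite mxE (negbTE ji) andbF.
  under eq_bigr do rewrite mxE [X in _ + X]mxE [X in _ * X]mxE [X in _ * (X + _)]mxE
    [X in _ * (_ * X + _)]mxE [X in _ * (_ * (_ + X) + _)]mxE
    [X in _ * (_ * (_ - X) + _)]mxE [X in _ * (_ + X)]mxE.
  rewrite big_split/= -mulr_sumr sumrB -mulr_sumr sumrB -mulr_sumr sd m1 l1 mulr1.
  by rewrite /c mulVf ?gt_eqF// subrr mulr0 addr0.
- by rewrite !mxE !eqxx/= mulr1 subrr mulr0 sub0r mulrN1 subrr.
- rewrite mulmxDl -scalemxAl mulmxBl -scalemxAl mulmxBl -scalemxAl lV -rowE.
  rewrite -[X in c *: (X - _)]scale1r -scalerBl scalerA mulVf ?gt_eqF//.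
  by rewrite scale1r subrr scaler0 addr0.
Qed.

(** The weights at [i] of the two end points are at most 1 and average to 1, so both equal 1. *)
Lemma irredundant_vertex N (V : 'M[R]_(N, d)) i : irredundant (cone_mx V) ->
  is_vertex (polytope V) (row i V).
Proof.
move=> irr; split.
  apply/polytope_cone; exists (delta_mx 0 i); first by move=> j; rewrite mxE.
  by rewrite -rowE row_cone_mx.
move=> _ _ t /polytopeP[a [a0 a1 ->]] /polytopeP[b [b0 b1 ->]] /andP[t0 t1] v.
have le1 (l : 'rV[R]_N) : nonneg_vec l -> \sum_j l 0 j = 1 -> l 0 i <= 1.
  by move=> l0 <-; rewrite (bigD1 i)//= lerDl sumr_ge0.
have eq1 (l : 'rV[R]_N) : nonneg_vec l -> \sum_j l 0 j = 1 -> l 0 i = 1 ->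
    l *m V = row i V.
  move=> l0 l1 li; rewrite rowE; congr (_ *m _); apply/rowP => j.
  rewrite mxE eqxx/=; have [->|ji] := eqVneq j i; first by rewrite li.
  move/eqP: l1; rewrite (bigD1 i)//= li -[X in _ == X]addr0 (inj_eq (addrI _)).
  by rewrite psumr_eq0// => /allP/(_ j (mem_index_enum _)); rewrite ji => /eqP.
have : (t *: a + (1 - t) *: b) 0 i = 1.
  apply: irr; first by move=> j; rewrite !mxE addr_ge0// mulr_ge0// ?subr_ge0 ltW.
  rewrite mul_cone_mx row_cone_mx v mulmxDl -!scalemxAl; congr at_height.
  under eq_bigr do rewrite !mxE.
  by rewrite big_split/= -!mulr_sumr a1 b1; ring.
rewrite !mxE => e; have ai := le1 a a0 a1; have bi := le1 b b0 b1.
by split; apply: eq1 => //; nra.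
Qed.

(** A generating list of minimal length has only vertices as rows, and vertices are lattice points.
    Full dimension makes the cone over it span. *)
Lemma integral_polytope_rows P : integral_polytope P -> has_dim P d ->
  exists N (V : 'M[R]_(N, d)), [/\ P = polytope V, irredundant (cone_mx V),
    forall i, lattice (row i V)
    & forall u, exists l : 'rV_N, l *m cone_mx V = u].
Proof.
move=> [cP vP] [v0 [W [affP dW]]].
have ex : exists N, `[< exists V : 'M[R]_(N, d), P = polytope V >].
  by have [N [V PV]] := convex_polytope_rows cP; exists N; apply/asboolP; exists V.
case: (ex_minnP ex) => N /asboolP[V PV] Nmin.
have irr : irredundant (cone_mx V).
  case: N V PV Nmin => [|N] V PV Nmin; first by move=> [].
  apply: minimal_irredundant => i PVi.
  suff /Nmin : `[< exists V : 'M[R]_(N, d), P = polytope V >] by rewrite ltnn.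
  by apply/asboolP; exists (row' i V); rewrite PV PVi.
exists N, V; split=> //.
  by move=> i; apply: vP; rewrite PV; exact: irredundant_vertex.
have Wf : W = fullv.
  by apply/eqP; rewrite eqEdim subvf dimvf dW /dim/= mul1n.
have span1 x : exists l : 'rV_N, l *m cone_mx V = at_height 1 x.
  have : aff_hull P x.
    by rewrite affP; exists (x - v0); [rewrite /= Wf memvf|rewrite addrC subrK].
  move=> [n [p [w [pP w1 ->]]]].
  have /choice[L LP] i : exists l : 'rV_N, l *m cone_mx V = at_height 1 (p i).
    by have := pP i; rewrite PV => /polytope_cone[l _ lp]; exists l.
  exists (\sum_i w i *: L i); rewrite mulmx_suml; apply: eq_at_height.
    rewrite summxE -[RHS]w1; apply: eq_bigr => i _.
    by rewrite -scalemxAl LP mxE at_height0 mulr1.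
  move=> j; rewrite !summxE; apply: eq_bigr => i _.
  by rewrite -scalemxAl LP mxE at_heightS mxE.
(* The representation [l'] of the origin at height 1 corrects the height. *)
move=> u; have [l lx] := span1 (base_part u); have [l' l'0] := span1 0.
exists (l + (u 0 0 - 1) *: l'); rewrite mulmxDl -scalemxAl lx l'0 -[RHS]base_partK.
apply: eq_at_height; first by rewrite !mxE unlift_none mulr1 addrC subrK.
by move=> j; rewrite !mxE liftK !mxE mulr0 addr0.
Qed.

End VertexRepresentation.

Theorem g3_lower_bound (R : realType) (d : nat) (P : set 'rV[R]_d) :
  (6 <= d)%N -> integral_polytope P -> has_dim P d ->
  g3_bound d (vol P) <= ehrhart_coef 3 P.
Proof.
move=> d6 iP dP; have [N [V [-> irr Vl span]]] := integral_polytope_rows iP dP.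
have d0 : (0 < d)%N by lia.
have [h [h0 count hd]] := cone_count span (cone_mx_lattice Vl) (cone_mx0 V).
have Ph n : (0 < n)%N ->
    lattice_count (polytope V) n = (\sum_(k < d.+1) h k * 'C(n + d - k, d))%N.
  by move=> n0; rewrite lattice_count_cone// count.
rewrite (ehrhart_coefE Ph) (g3_boundE (h := h))//; last first.
  by rewrite /vol (outer_measure_polytope d0 Vl span count).
rewrite ler_pM2l ?invr_gt0 ?ltr0n ?fact_gt0// ler_int.
by apply: h_vector_bound => //; exact: hd.
Qed.

(** * Simplices attaining the bound *)

Section SpanningPolytopes.
Variables (R : realType) (d N : nat) (V : 'M[R]_(N, d)).

(** If a row has weight strictly between 0 and 1, the vertex lies strictly between that row and the
    rescaled rest, so it equals the row. *)
Lemma vertex_is_row v : is_vertex (polytope V) v -> exists i, v = row i V.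
Proof.
move=> [/polytopeP[l [l0 l1 vE]] ext].
have [i li] : exists i, 0 < l 0 i.
  apply: contrapT => /forallNP nl; have : \sum_i l 0 i <= 0.
    by apply: sumr_le0 => i _; rewrite leNgt; apply/negP/nl.
  by rewrite l1 ler10.
have rowP' j : polytope V (row j V).
  apply/polytope_cone; exists (delta_mx 0 j); first by move=> k; rewrite mxE.
  by rewrite -rowE row_cone_mx.
exists i; have sd : \sum_j (delta_mx 0 i : 'rV[R]_N) 0 j = 1.
  rewrite (bigD1 i)//= mxE !eqxx big1 ?addr0// => j ji.
  by rewrite mxE (negbTE ji) andbF.
have rest : l - l 0 i *: delta_mx 0 i = \row_j (if j == i then 0 else l 0 j).
  apply/rowP => j; rewrite !mxE eqxx/=; have [->|ji] := eqVneq j i.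
    by rewrite mulr1 subrr.
  by rewrite mulr0 subr0.
have le1 : l 0 i <= 1 by rewrite -l1 (bigD1 i)//= lerDl sumr_ge0.
have srest : \sum_j (l - l 0 i *: delta_mx 0 i) 0 j = 1 - l 0 i.
  under eq_bigr do rewrite mxE [X in _ + X]mxE [X in - X]mxE.
  by rewrite sumrB -mulr_sumr sd l1 mulr1.
have rest0 : nonneg_vec (l - l 0 i *: delta_mx 0 i).
  by move=> j; rewrite rest mxE; case: ifP.
have [li1|li1] := eqVneq (l 0 i) 1.
  have r0 : l - l 0 i *: delta_mx 0 i = 0.
    move: srest; rewrite li1 subrr -li1 => /eqP; rewrite psumr_eq0// => /allP z.
    by apply/rowP => j; rewrite [RHS]mxE; apply/eqP/(z j (mem_index_enum _)).
  by rewrite vE rowE; congr (_ *m _); apply/eqP; rewrite -subr_eq0 -r0 li1 scale1r.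
have cp : 0 < 1 - l 0 i by rewrite subr_gt0 lt_neqAle li1.
pose r := (1 - l 0 i)^-1 *: (l - l 0 i *: delta_mx 0 i).
have [] := ext (row i V) (r *m V) (l 0 i) (rowP' i).
- apply/polytopeP; exists r; split=> //.
    by move=> j; rewrite mxE mulr_ge0 ?invr_ge0// ltW.
  by under eq_bigr do rewrite mxE; rewrite -mulr_sumr srest mulVf// gt_eqF.
- by rewrite li -subr_gt0.
- rewrite /r -scalemxAl scalerA mulfV ?gt_eqF// scale1r mulmxBl -vE -scalemxAl -rowE.
  by rewrite addrC subrK.
- by move=> <-.
Qed.

Lemma polytope_integral : (forall i, lattice (row i V)) -> integral_polytope (polytope V).
Proof.
move=> Vl; split; last by move=> v /vertex_is_row[i ->].
exists [set row i V | i in [set: 'I_N]]; split=> //.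
by apply: finite_image; exact: finite_finset.
Qed.

Lemma polytope_full_dim : (forall u, exists l : 'rV_N, l *m cone_mx V = u) ->
  has_dim (polytope V) d.
Proof.
move=> span; exists 0, fullv; split; last by rewrite dimvf /dim/= mul1n.
apply/seteqP; split=> x _; first by exists x; rewrite ?add0r//= memvf.
have [l] := span (at_height 1 x); rewrite mul_cone_mx => lx.
exists N, (fun i => row i V), (l 0); split.
- move=> i; apply/polytope_cone; exists (delta_mx 0 i); first by move=> k; rewrite mxE.
  by rewrite -rowE row_cone_mx.
- by have := congr1 (fun v : 'rV_d.+1 => v 0 0) lx; rewrite !at_height0.
- by have := congr1 (@base_part R d) lx; rewrite !at_heightK mulmx_sum_row => ->.
Qed.

End SpanningPolytopes.

Section BoxHeights.
Variables (s m' : nat).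
Let m := m'.+1.

Definition box_ht (j : nat) : nat := if j == 0%N then 0%N else s.

(** For [s > 0], the coefficients of 1 + m' t^s. *)
Definition simplex_h (k : nat) : nat := #|[set j : 'I_m | box_ht j == k]%SET|.

Lemma simplex_h_sum d (T : nmodType) (F : nat -> T) : (s <= d)%N ->
  \sum_(k < d.+1) F k *+ simplex_h k = F 0%N + F s *+ m'.
Proof.
move=> sd; transitivity (\sum_(j < m) F (box_ht j)); last first.
  rewrite big_ord_recl; congr (_ + _).
  by rewrite (eq_bigr (fun=> F s))// sumr_const card_ord.
transitivity (\sum_(k < d.+1) \sum_(j < m | box_ht j == k) F k).
  apply: eq_bigr => k _; rewrite -sumr_const; apply: eq_bigl => j.
  by rewrite finset.in_set.
rewrite (exchange_big_dep predT)//=; apply: eq_bigr => j _.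
have jd : (box_ht j < d.+1)%N by rewrite /box_ht; case: eqP => _ //; lia.
by rewrite (big_pred1 (Ordinal jd))// => k; rewrite -val_eqE eq_sym.
Qed.

End BoxHeights.

(* In dimension d + 1, the simplex with vertices 0, e_1, ..., e_d and the apex
   e_1 + ... + e_s - e_(s+1) - ... - e_(2s-1) + m e_(d+1). *)
Section ReeveSimplex.
Variables (R : realType) (d s m' : nat).
Let m := m'.+1.
Hypotheses (s0 : (0 < s)%N) (sd : (s + s <= d.+1)%N).

Definition apex (k : nat) : R :=
  if (k < s)%N then 1 else if (k < s + s - 1)%N then -1 else 0.

Definition simplex_mx : 'M[R]_(d.+2, d.+1) := \matrix_(i, j)
  if unlift ord0 i is Some k then
    if k == ord_max then (if j == ord_max then m%:R else apex j) else (k == j)%:R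
  else 0.

Let B := cone_mx simplex_mx.

Lemma simplex_mx_lattice i : lattice (row i simplex_mx).
Proof.
move=> j; rewrite !mxE; case: unliftP => [k _|_]; last exact: rpred0.
rewrite /apex; case: ifP => _; last exact: natr_int.
by do 3?[case: ifP => _]; rewrite ?rpredN ?rpred1 ?rpred0 ?natr_int.
Qed.

Lemma sum_apex : \sum_(k < d) apex k = 1.
Proof.
rewrite -(big_mkord xpredT apex) (big_cat_nat (n := s))/=; [|lia..].
rewrite [X in _ + X](big_cat_nat (n := (s + s - 1)%N))/=; [|lia..].
have -> : \sum_(0 <= k < s) apex k = \sum_(0 <= k < s) 1.
  by apply: eq_big_nat => k /andP[_ ks]; rewrite /apex ks.
have -> : \sum_(s <= k < s + s - 1) apex k = \sum_(s <= k < s + s - 1) -1.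
  by apply: eq_big_nat => k /andP[sk ks]; rewrite /apex ltnNge sk/= ks.
have -> : \sum_(s + s - 1 <= k < d) apex k = \sum_(s + s - 1 <= k < d) 0.
  apply: eq_big_nat => k /andP[sk _]; rewrite /apex !ltnNge sk/=.
  by rewrite (leq_trans _ sk)//; lia.
rewrite big1_eq addr0 !sumr_const_nat subn0 (_ : (s + s - 1 - s = s.-1)%N); last lia.
by rewrite mulNrn -{1}(prednK s0) -natr1 addrAC subrr add0r.
Qed.

Lemma mul_simplex_mx (c0 : R) (c : 'rV[R]_d.+1) :
  at_height c0 c *m B = at_height (c0 + \sum_k c 0 k)
    (\row_j (if j == ord_max then m%:R * c 0 ord_max else c 0 j + apex j * c 0 ord_max)).
Proof.
rewrite mul_cone_mx; apply: eq_at_height.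
  rewrite at_height0 big_ord_recl at_height0; congr (_ + _).
  by apply: eq_bigr => k _; rewrite at_heightS.
move=> j; rewrite at_heightS [LHS]mxE [RHS]mxE big_ord_recl.
rewrite [simplex_mx _ _]mxE unlift_none mulr0 add0r (bigD1 ord_max)//=.
rewrite at_heightS [simplex_mx _ _]mxE liftK eqxx.
under eq_bigr => k km do rewrite at_heightS mxE liftK (negbTE km).
have [->|jm] := eqVneq j ord_max.
  by rewrite mulrC big1 ?addr0// => k km; rewrite (negbTE km) mulr0.
rewrite addrC mulrC; congr (_ + _); rewrite (bigD1 j)//= eqxx mulr1 big1 ?addr0//.
by move=> k /andP[_ kj]; rewrite (negbTE kj) mulr0.
Qed.

Definition apex_coord (x : 'rV[R]_d.+2) : 'rV[R]_d.+1 := \row_k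
  if k == ord_max then x 0 (lift ord0 ord_max) / m%:R
  else x 0 (lift ord0 k) - apex k * (x 0 (lift ord0 ord_max) / m%:R).

Definition simplex_coord (x : 'rV[R]_d.+2) : 'rV[R]_d.+2 :=
  at_height (x 0 0 - \sum_k apex_coord x 0 k) (apex_coord x).

Lemma apex_coord_max x : apex_coord x 0 ord_max = x 0 (lift ord0 ord_max) / m%:R.
Proof. by rewrite mxE eqxx. Qed.

Lemma apex_coord_lt x k : k != ord_max ->
  apex_coord x 0 k = x 0 (lift ord0 k) - apex k * (x 0 (lift ord0 ord_max) / m%:R).
Proof. by move=> km; rewrite mxE (negbTE km). Qed.

Let mR : m%:R != 0 :> R. Proof. by rewrite pnatr_eq0. Qed.

Lemma simplex_coordK x : simplex_coord x *m B = x.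
Proof.
rewrite mul_simplex_mx subrK; apply/esym/eq_at_height => // j.
rewrite [RHS]mxE apex_coord_max; have [->|jm] := eqVneq j ord_max.
  by rewrite mulrC divfK.
by rewrite apex_coord_lt// subrK.
Qed.

Lemma simplex_spanning u : exists l : 'rV_d.+2, l *m B = u.
Proof. by exists (simplex_coord u); exact: simplex_coordK. Qed.

Lemma simplex_unit : B \in unitmx.
Proof.
rewrite -row_full_unit -sub1mx; apply/row_subP => i.
by rewrite -(simplex_coordK (row i 1%:M)) submxMl.
Qed.

Lemma invmx_simplex x : x *m invmx B = simplex_coord x.
Proof. by rewrite -{1}(simplex_coordK x) mulmxK// simplex_unit. Qed.

(* The entries of the apex other than m sum to 1, so that the coordinate at the
   origin is integral on lattice points. *)
Lemma simplex_coord0 x : simplex_coord x 0 0 =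
  x 0 0 - \sum_(k < d) x 0 (lift ord0 (widen_ord (leqnSn d) k)).
Proof.
rewrite at_height0 big_ord_recr/= apex_coord_max.
have kE (k : 'I_d) : widen_ord (leqnSn d) k != ord_max.
  by rewrite -val_eqE/= ltn_eqF.
under eq_bigr do rewrite apex_coord_lt//.
by rewrite sumrB -mulr_suml sum_apex mul1r subrK.
Qed.

Lemma simplex_box x : in_box B (fun=> false) x <->
  lattice x /\ forall i, 0 <= simplex_coord x 0 i < 1.
Proof.
by split=> -[xl xb]; split=> // i; have := xb i; rewrite invmx_simplex.
Qed.

(** The last entry fixes the weight on the apex, hence every other coordinate modulo 1, and box
    coordinates lie in [0, 1). *)
Lemma simplex_box_inj x x' : in_box B (fun=> false) x -> in_box B (fun=> false) x' ->
  x 0 (lift ord0 ord_max) = x' 0 (lift ord0 ord_max) -> x = x'.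
Proof.
move=> /simplex_box[xl xb] /simplex_box[x'l x'b] e.
have int_eq (a b a' b' : R) : a \is a Num.int -> b \is a Num.int ->
    0 <= a' < 1 -> 0 <= b' < 1 -> a' - b' = a - b -> a = b.
  move=> /intrP[p ->] /intrP[q ->] /andP[? ?] /andP[? ?] E.
  have [h1 h2] : p%:~R - q%:~R < 1%:~R :> R /\ q%:~R - p%:~R < 1%:~R :> R by split; lra.
  by move: h1 h2; rewrite -!intrB !ltr_int => h1 h2; congr _%:~R; lia.
have eS k : x 0 (lift ord0 k) = x' 0 (lift ord0 k).
  have [->//|km] := eqVneq k ord_max.
  apply: (int_eq _ _ _ _ (xl _) (x'l _) (xb (lift ord0 k)) (x'b (lift ord0 k))).
  by rewrite !at_heightS !apex_coord_lt// e; ring.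
rewrite -(base_partK x) -(base_partK x'); congr at_height; last first.
  by apply/rowP => k; rewrite !mxE eS.
apply: (int_eq _ _ _ _ (xl 0) (x'l 0) (xb 0) (x'b 0)); rewrite !simplex_coord0.
by under eq_bigr do rewrite eS; ring.
Qed.

(** With weight q = j/m on the apex, 0 < q < 1, integrality forces 1 - q on the [s] entries 1 and q
    on the [s - 1] entries -1; the total height is q + s(1 - q) + (s - 1)q = s, with weight 0 at the
    origin. *)
Definition box_pt (j : nat) : 'rV[R]_d.+2 := at_height (box_ht s j)%:R
  (\row_k if k == ord_max then j%:R else ((0 < j) && (k < s))%N%:R).

Lemma box_pt_box (j : nat) : (j < m)%N -> in_box B (fun=> false) (box_pt j).
Proof.
move=> jm; apply/simplex_box; have m0 : 0 < m%:R :> R by rewrite ltr0n.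
have qE : 0 <= (j%:R / m%:R : R) < 1.
  by rewrite divr_ge0//= ltr_pdivrMr// mul1r ltr_nat.
split.
  apply/lattice_at_height => k; rewrite mxE; case: ifP => _; exact: natr_int.
move=> i; case: (unliftP ord0 i) => [k ->|->]; last first.
  rewrite simplex_coord0 at_height0.
  have kE (k : 'I_d) : widen_ord (leqnSn d) k != ord_max.
    by rewrite -val_eqE/= ltn_eqF.
  under eq_bigr do rewrite at_heightS mxE (negbTE (kE _))/=.
  rewrite -(big_mkord xpredT (fun k => ((0 < j) && (k < s))%N%:R)).
  rewrite (big_cat_nat (n := s))/=; [|lia..].
  have -> : \sum_(0 <= k < s) ((0 < j) && (k < s))%N%:R = (box_ht s j)%:R :> R.
    transitivity (\sum_(0 <= k < s) (0 < j)%N%:R : R).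
      by apply: eq_big_nat => k /andP[_ ->]; rewrite andbT.
    by rewrite sumr_const_nat subn0 /box_ht lt0n; case: eqP; rewrite ?mul0rn.
  rewrite big_nat_cond big1 ?addr0 ?subrr ?lexx ?ltr01// => k /andP[/andP[sk _] _].
  by rewrite [(k < s)%N]ltnNge sk andbF.
rewrite at_heightS; have [->|km] := eqVneq k ord_max.
  by rewrite apex_coord_max at_heightS mxE eqxx.
rewrite apex_coord_lt// !at_heightS !mxE eqxx (negbTE km) /apex.
have [->|j0] := posnP j.
  by rewrite !mul0r mulr0 subrr lexx ltr01.
have q0 : 0 < j%:R / m%:R :> R by rewrite divr_gt0// ltr0n.
move: qE q0; set q := _ / _; move: q => q /andP[qa qb] q0 /=.
by case: ifP => _ /=; [|case: ifP => _]; apply/andP; split; lra.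
Qed.

Lemma box_ptP x : in_box B (fun=> false) x -> exists2 j, (j < m)%N & x = box_pt j.
Proof.
move=> xbox; have /simplex_box[xl xb] := xbox.
have := xb (lift ord0 ord_max); rewrite at_heightS apex_coord_max.
have m0 : 0 < m%:R :> R by rewrite ltr0n.
have [z zE] := intrP (xl (lift ord0 ord_max)).
rewrite ltr_pdivrMr// mul1r pmulr_lge0 ?invr_gt0// zE -[m%:R]/((m%:Z)%:~R : R).
rewrite ler0z ltr_int; case: z zE => // j zE /andP[_ jm].
exists j => //; apply: simplex_box_inj => //; first exact: box_pt_box.
by rewrite zE at_heightS mxE eqxx.
Qed.

Lemma simplex_box_slice k : ncard (box_slice B (fun=> false) k) = simplex_h s m' k.
Proof.
rewrite /simplex_h -(@ncard_finType _ _ _ (fun j : 'I_m => box_pt j)); last first.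
  move=> i j _ _ /(congr1 (fun v : 'rV[R]_d.+2 => v 0 (lift ord0 ord_max))).
  by rewrite !at_heightS !mxE eqxx => /eqP; rewrite eqr_nat => /eqP/val_inj.
congr ncard; apply/seteqP; split=> x /=.
  move=> [/box_ptP[j jm ->]]; rewrite at_height0 => /eqP; rewrite eqr_nat => jk.
  by exists (Ordinal jm) => //; rewrite finset.in_set.
move=> [j]; rewrite finset.in_set => /eqP jk <-; split; first exact: box_pt_box.
by rewrite at_height0 jk.
Qed.

(** The whole cone is a single cell with no facet removed, so its h-vector is read off from one
    closed box. *)
Lemma simplex_count n : ncard (cone_slice B n) =
  (\sum_(k < d.+2) simplex_h s m' k * 'C(n + d.+1 - k, d.+1))%N.
Proof.
have -> : cone_slice B n = slice B (fun=> false) n.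
  apply/seteqP; split=> x.
    move=> [xl xn [l l0 lx]]; split=> // i.
    by rewrite -lx mulmxK ?simplex_unit//; exact: l0.
  move=> [xl xh xn]; split=> //; exists (x *m invmx B) => //.
  by rewrite mulmxKV// simplex_unit.
rewrite ncard_slice//.
- by apply: eq_bigr => k _; rewrite simplex_box_slice.
- exact: simplex_unit.
- exact/cone_mx_lattice/simplex_mx_lattice.
- exact: cone_mx0.
- by exists ord0.
Qed.

End ReeveSimplex.

Theorem g3_bound_attained (R : realType) (d m : nat) : (6 <= d)%N -> (0 < m)%N ->
  exists P : set 'rV[R]_d,
    [/\ integral_polytope P, has_dim P d, d`!%:R * vol P = m%:R
      & ehrhart_coef 3 P = g3_bound d (vol P)].
Proof.
case: d => // d d6; case: m => // m _.
pose s := extremal_shift d.+1.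
have s0 : (0 < s)%N by rewrite /s /extremal_shift; case: ifP.
(* For [s = 3] this is exactly the assumption that the dimension is at least 6. *)
have sd : (s + s <= d.+1)%N by rewrite /s /extremal_shift; case: ifP => _; lia.
pose V := simplex_mx R d s m; exists (polytope V).
have Vl : forall i, lattice (row i V) by exact: simplex_mx_lattice.
have span : forall u, exists l : 'rV_d.+2, l *m cone_mx V = u.
  exact: simplex_spanning.
have count := simplex_count R m s0 sd.
have sd' : (s <= d.+1)%N by lia.
have hsum : (\sum_(k < d.+2) simplex_h s m k = m.+1)%N.
  have := simplex_h_sum m (fun=> 1 : nat) sd'.
  by under eq_bigr do rewrite natn; rewrite natn.
have volE : vol (polytope V) = m.+1%:R / d.+1`!%:R.
  by rewrite /vol (outer_measure_polytope _ Vl span count)// hsum.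
have f0 : d.+1`!%:R != 0 :> R by rewrite pnatr_eq0 -lt0n fact_gt0.
split; [exact: polytope_integral|exact: polytope_full_dim|by rewrite volE mulrC divfK|].
rewrite (ehrhart_coefE (h := simplex_h s m)); last first.
  by move=> n n0; rewrite lattice_count_cone// count.
rewrite (g3_boundE (h := simplex_h s m))//; last by rewrite volE hsum.
congr (_ * _%:~R); rewrite hsum.
have := simplex_h_sum m (fun k => c_coef d.+1 3 (d.+1%:Z - k%:Z)) sd'.
rewrite subr0 (_ : m.+1%:Z - 1 = m%:Z); last lia.
move=> e; rewrite [_ * c_coef _ _ _ in RHS]mulrC -[m%:Z]natz mulr_natr -e.
by apply: eq_bigr => k _; rewrite mulrC -[(simplex_h s m k)%:Z]natz mulr_natr.
Qed.

Theorem theorem1p3 (R : realType) (d : nat) (hd : (6 <= d)%N) :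
  (forall P : set 'rV[R]_d, integral_polytope P -> has_dim P d ->
     g3_bound d (vol P) <= ehrhart_coef 3 P) /\
  (forall m : nat, (0 < m)%N ->
     exists P : set 'rV[R]_d,
       [/\ integral_polytope P, has_dim P d, d`!%:R * vol P = m%:R
         & ehrhart_coef 3 P = g3_bound d (vol P)]).
Proof.
split; first by move=> P; exact: g3_lower_bound.
by move=> m; exact: g3_bound_attained.
Qed.
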